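(* Let $f\in \mathrm{Lip}(\mathbb{R})$ have compact support and let $\sigma$ be a (signed) compactly supported Borel measure on $\mathbb{R}$ with finite total variation such that $\int_{\mathbb{R}}x^k\,d\sigma(x)=0$ for $k=0,1$. Let $M>0$ be such that the support of $\sigma$ is contained in the interval $(-M,M)$. Define $$\widetilde{\Theta}^\sigma_\varepsilon f(x):=\int_\varepsilon^1\Delta_\sigma f(x,h)\,\frac{dh}{h^2},\qquad \Delta_\sigma f(x,h):=\int_{\mathbb{R}}f(x+hw)\,d\sigma(w),\qquad x\in\mathbb{R}.$$ Then there exists a Calderón–Zygmund kernel $K_0$ on $\mathbb{R}\setminus\{0\}$ such that $$\sup_{0<\varepsilon<1}\Big|\widetilde{\Theta}^\sigma_\varepsilon f(x)-\int_{|t|>\varepsilon M}K_0(t)\,f'(x-t)\,dt\Big|$$ is uniformly bounded for $x\in\mathbb{R}$. In particular, $$\sup_{0<\varepsilon<1}|\widetilde{\Theta}^\sigma_\varepsilon f(x)|<\infty$$ for almost every $x\in\mathbb{R}$.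
   Context: $\mathrm{Lip}(\mathbb{R})$ is the class of functions $f:\mathbb{R}\to\mathbb{R}$ with $\sup_{x\in\mathbb{R},\,h\neq0}\frac{|f(x+h)-f(x)|}{|h|}<\infty$; such $f$ is differentiable almost everywhere, and $f'$ denotes its a.e. derivative. A Calderón–Zygmund kernel on $\mathbb{R}\setminus\{0\}$ is a locally integrable function $K$ on $\mathbb{R}\setminus\{0\}$ such that the following three quantities are finite: $$\sup_{R>0}\int_{R\le|x|\le2R}|K(x)|\,dx,\qquad \sup_{y\ne0}\int_{|x|\ge2|y|}|K(x-y)-K(x)|\,dx,\qquad \sup_{0<R_1<R_2<\infty}\Big|\int_{R_1\le|x|\le R_2}K(x)\,dx\Big|.$$ *)

(* Defs.v *)
From HB Require Import structures.
From mathcomp Require Import all_boot all_order all_algebra.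
From mathcomp Require Import all_classical all_reals all_analysis.

Set Implicit Arguments.
Unset Strict Implicit.
Unset Printing Implicit Defensive.

Import Order.TTheory GRing.Theory Num.Theory.
Import numFieldNormedType.Exports.

Local Open Scope classical_set_scope.
Local Open Scope ring_scope.
Local Open Scope ereal_scope.

Section signed_integration.
Context d (T : measurableType d) (R : realType).
Variable nu : {charge set T -> \bar R}.

Lemma exists_hahn_decomposition :
  exists PN : set T * set T, hahn_decomposition nu PN.1 PN.2.
Proof. by have [P [N PN]] := Hahn_decomposition nu; exists (P, N). Qed.

(* The Jordan parts built from it do not depend on the chosen pair: see
   [Hahn_decomposition_uniq]. *)
Definition hahn_pair := cid exists_hahn_decomposition.

(* [nu] is finite-valued by definition of a charge, hence so is its total
   variation. *)
Definition charge_total_variation : set T -> \bar R :=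
  charge_variation (projT2 hahn_pair).

Definition charge_integral (g : T -> \bar R) : \bar R :=
  \int[jordan_pos (projT2 hahn_pair)]_w g w -
  \int[jordan_neg (projT2 hahn_pair)]_w g w.

End signed_integration.

Section kernels_and_operators.
Context {R : realType}.
Local Notation mu := (@lebesgue_measure R).
Implicit Types (K f g : R -> R) (sigma : {charge set (measurableTypeR R) -> \bar R}).

(* Support of the total variation, i.e. the complement of the largest open set
   that is null for sigma. *)
Definition charge_support sigma : set R :=
  [set x | forall U : set R, open_nbhs x U -> 0 < charge_total_variation sigma U].

Definition function_support f : set R := closure [set x | f x != 0%R].

(* K is total, but its value at 0 is irrelevant: no domain below reaches 0. *)
Definition calderon_zygmund_kernel K : Prop :=
  [/\ locally_integrable (~` [set 0%R]) K,
      ereal_sup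
        [set \int[mu]_(x in [set x | (r <= `|x| <= 2 * r)%R]) `|K x|%:E
           | r in [set r : R | (0 < r)%R]] < +oo,
      ereal_sup
        [set \int[mu]_(x in [set x | (2 * `|y| <= `|x|)%R]) `|K (x - y) - K x|%:E
           | y in [set y : R | y != 0%R]] < +oo &
      ereal_sup
        [set `| \int[mu]_(x in [set x | (r.1 <= `|x| <= r.2)%R]) (K x)%:E |
           | r in [set r : R * R | (0 < r.1 < r.2)%R]] < +oo].

(* Integrals are kept in the extended reals, so that a bound on them is never
   obtained from a default value. *)
Definition sigma_difference sigma f (x h : R) : \bar R :=
  charge_integral sigma (fun w : R => (f (x + h * w)%R)%:E).

Definition theta sigma f (eps x : R) : \bar R :=
  \int[mu]_(h in `[eps, 1%R]) (sigma_difference sigma f x h * (h ^- 2)%:E).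

Definition truncated_convolution K g (delta x : R) : \bar R :=
  \int[mu]_(t in [set t | (delta < `|t|)%R]) (K t * g (x - t))%:E.

End kernels_and_operators.

(* Main.v *)
Require Import Defs.
From HB Require Import structures.
From mathcomp Require Import all_boot all_order all_algebra.
From mathcomp Require Import all_classical all_reals all_analysis.
From mathcomp Require Import measurable_realfun ring lra.

(** Write [S v] for the charge [sigma] of the half-line of the points [w >= v].
The moment conditions say that [S] vanishes outside the interval from [- M] to
[M] and has integral 0, so its primitive [Psi], where [Psi t] is the integral of
[S v] over [v <= t], is a Lipschitz function supported in the same interval. Put
[Phi t = Psi (- t)].

A compactly supported Lipschitz [f] is the primitive of a bounded Borel function
[g] equal to [f'] almost everywhere ([lipschitz_density]). Integrating by parts
against [sigma] ([charge_integral_representation]) turns the difference at scale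
[h] into [h] times the integral of [g (x + h * v) * S v]. Substituting
[u = h * v] and exchanging the integrals in [h] and [v], the scale integral
becomes an integral of [S] between [u] and [u / eps], hence
([scale_integral_primitive]) [theta] at [eps] is the integral of
[g (x - t) * (Phi t - Phi (t / eps)) / t]. The kernel is [K0 t = Phi t / t]. For
[eps * M < `|t|] the second term is 0, and for [`|t| <= eps * M] the Lipschitz
condition bounds the quotient by a multiple of [1 / eps], so that this part
contributes a bounded amount ([theta_comparison]). That [K0] is a
Calderon-Zygmund kernel uses only that [Phi] is Lipschitz with compact support
([quotient_kernel_cz]).

Since [K0 t] is [Phi 0 / t] plus a bounded function, the last assertion amounts
to the almost everywhere boundedness, in the truncation, of the truncated Hilbert
transforms of the bounded compactly supported function [g]
([truncated_hilbert_bounded]). This is Cotlar's argument, in a form where only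
uniform bounds on smooth regularisations are needed. Let [T_s] be the convolution
with the conjugate Poisson kernel [u / (u ^+ 2 + s ^+ 2)]. The correlation of two
translates of this kernel is computed by partial fractions
([conj_poisson_correlation]) and is uniformly integrable, which bounds [T_s] in
L2 over bounded windows, uniformly in [s] ([conj_poisson_int_L2_bound]). For
[s <= e] the transform truncated at [2 * e] is bounded by a constant plus the
mean of [T_s g ^+ 2] over the interval of radius [e] around [x] ([cotlar]), hence
by the Hardy-Littlewood maximal function of a function whose integral is bounded
uniformly in [s]. The weak-type inequality, applied to a sequence of [s] tending
to 0, shows that the set where the truncations are unbounded is null. *)

Set Implicit Arguments.
Unset Strict Implicit.
Unset Printing Implicit Defensive.
Import Order.TTheory GRing.Theory Num.Theory.
Import numFieldNormedType.Exports.
Local Open Scope classical_set_scope.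
Local Open Scope ring_scope.

(** * Integration on the line *)

Section integral_toolkit.
Context d (T : measurableType d) (R : realType) (m : {measure set T -> \bar R}).
Implicit Types f g : T -> R.

Lemma integrable_dominated f g : measurable_fun setT f ->
  m.-integrable setT (EFin \o g) -> (forall x, `|f x| <= g x) ->
  m.-integrable setT (EFin \o f).
Proof.
move=> mf ig fg; apply: le_integrable ig => //; first exact/measurable_EFinP.
by move=> x _; rewrite /= lee_fin (le_trans (fg x))// ler_norm.
Qed.

Lemma norm_Rintegral_le f g : measurable_fun setT f ->
  m.-integrable setT (EFin \o g) -> (forall x, `|f x| <= g x) ->
  `|\int[m]_x f x| <= \int[m]_x g x.
Proof.
move=> mf ig fg; have intf := integrable_dominated mf ig fg.
apply: (le_trans (le_normr_Rintegral measurableT intf)).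
by apply: le_Rintegral => //; exact: integrable_norm.
Qed.

Lemma EFin_Rintegral f : m.-integrable setT (EFin \o f) ->
  (\int[m]_x f x)%:E = (\int[m]_x (f x)%:E)%E.
Proof. by move=> intf; rewrite /Rintegral fineK// integrable_fin_num. Qed.

End integral_toolkit.

Section fubini.
Context d1 d2 (T1 : measurableType d1) (T2 : measurableType d2) (R : realType).
Variables (m1 : {sigma_finite_measure set T1 -> \bar R}).
Variables (m2 : {sigma_finite_measure set T2 -> \bar R}).
Variables (F : T1 -> T2 -> R) (phi : T1 -> R).
Hypothesis mF : measurable_fun setT (fun z : T1 * T2 => F z.1 z.2).
Hypothesis iF1 : forall x, m2.-integrable setT (EFin \o F x).
Hypothesis iF2 : forall y, m1.-integrable setT (EFin \o F^~ y).
Hypothesis iphi : m1.-integrable setT (EFin \o phi).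
Hypothesis Fphi : forall x, \int[m2]_y `|F x y| <= phi x.

Let G (z : T1 * T2) := (F z.1 z.2)%:E.

Let mG : measurable_fun setT G. Proof. exact/measurable_EFinP. Qed.

Let intG : (m1 \x m2)%E.-integrable setT G.
Proof.
apply/integrable12ltyP => //.
have /integrableP[mphi phioo] := iphi.
apply: le_lt_trans phioo; apply: ge0_le_integral => //.
- by move=> x _; exact: integral_ge0.
- apply: (measurable_fun_fubini_tonelli_F (abse \o G)) => //=.
  exact: measurableT_comp.
- exact: measurableT_comp.
- move=> x _; apply: (@le_trans _ _ (phi x)%:E); last by rewrite lee_fin ler_norm.
  rewrite -[leLHS]fineK; last first.
    rewrite ge0_fin_numE; last exact: integral_ge0.
    by have /integrableP[] := iF1 x.
  by rewrite lee_fin; exact: Fphi.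
Qed.

Lemma integrable_fubini1 : m1.-integrable setT (EFin \o (fun x => \int[m2]_y F x y)).
Proof.
apply: eq_integrable (integrable_fubini_F intG) => // x _.
by rewrite /= EFin_Rintegral.
Qed.

Lemma Rintegral_fubini : \int[m1]_x \int[m2]_y F x y = \int[m2]_y \int[m1]_x F x y.
Proof.
rewrite /Rintegral; congr fine.
under eq_integral do rewrite EFin_Rintegral//.
under [RHS]eq_integral do rewrite EFin_Rintegral//.
exact: (Fubini intG).
Qed.

End fubini.

Section lebesgue_toolkit.
Context {R : realType}.
Local Notation mu := (@lebesgue_measure R).
Implicit Types f g : R -> R.

Lemma lebesgue_dominated f g : measurable_fun [set: R] f ->
  mu.-integrable setT (EFin \o g) -> (forall x, `|f x| <= g x) ->
  mu.-integrable setT (EFin \o f).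
Proof. exact: (@integrable_dominated _ (measurableTypeR R) R mu f g). Qed.

Lemma lebesgue_norm_le f g : measurable_fun [set: R] f ->
  mu.-integrable setT (EFin \o g) -> (forall x, `|f x| <= g x) ->
  `|\int[mu]_x f x| <= \int[mu]_x g x.
Proof. exact: (@norm_Rintegral_le _ (measurableTypeR R) R mu f g). Qed.

Lemma lebesgue_integrableZ f c : mu.-integrable setT (EFin \o f) ->
  mu.-integrable setT (EFin \o (fun x => c * f x)).
Proof. by move=> /(integrableZl measurableT c); exact: eq_integrable. Qed.

Lemma lebesgue_integrableD f g : mu.-integrable setT (EFin \o f) ->
  mu.-integrable setT (EFin \o g) ->
  mu.-integrable setT (EFin \o (fun x => f x + g x)).
Proof. by move=> hf hg; have := integrableD measurableT hf hg; exact: eq_integrable. Qed.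

Lemma le_lebesgue_add3 f p q r : mu.-integrable setT (EFin \o f) ->
  mu.-integrable setT (EFin \o p) -> mu.-integrable setT (EFin \o q) ->
  mu.-integrable setT (EFin \o r) -> (forall x, f x <= p x + (q x + r x)) ->
  \int[mu]_x f x <= \int[mu]_x p x + (\int[mu]_x q x + \int[mu]_x r x).
Proof.
move=> hf hp hq hr fpqr; have hqr := lebesgue_integrableD hq hr.
rewrite -(RintegralD measurableT hq hr) -(RintegralD measurableT hp hqr).
by apply: le_Rintegral => //; exact: lebesgue_integrableD.
Qed.

(** Inversion is continuous off 0 and a singleton is measurable. *)
Lemma measurable_inv_fun : measurable_fun [set: R] (fun x : R => x^-1).
Proof.
have -> : [set: R] = [set 0] `|` ~` [set 0] by rewrite setUv.
apply/measurable_funU; [exact: measurable_set1|by apply: measurableC; exact: measurable_set1|split].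
  exact: measurable_fun_set1.
apply: open_continuous_measurable_fun.
  by apply: closed_openC; exact: closed_eq.
by move=> x; rewrite inE => /eqP x0; exact: inv_continuous.
Qed.

Lemma integrable_itv_cst (a b c : R) :
  mu.-integrable setT (EFin \o (fun x => if a <= x <= b then c else 0)).
Proof.
have : mu.-integrable `[a, b] (EFin \o cst c).
  apply: measurable_bounded_integrable => //=; last exact: bounded_cst.
  by rewrite lebesgue_measure_itv/=; case: ifPn => // _; rewrite -EFinB ltry.
rewrite integrable_mkcond//; apply: eq_integrable => // x _.
by rewrite patchE /= mem_setE in_itv/=; case: ifPn.
Qed.

Lemma Rintegral_itv_cst (a b c : R) : a <= b ->
  \int[mu]_x (if a <= x <= b then c else 0) = c * (b - a).
Proof.
move=> ab; have -> : \int[mu]_x (if a <= x <= b then c else 0) =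
    \int[mu]_(x in `[a, b]) c.
  rewrite [RHS]Rintegral_mkcond; apply: eq_Rintegral => x _.
  by rewrite patchE mem_setE in_itv/=; case: ifPn.
rewrite Rintegral_cst//= lebesgue_measure_itv/= lte_fin.
case: ltP => //= ba; have -> : b = a by lra.
lra.
Qed.

Lemma integrable_bounded_supp f (B C : R) : measurable_fun setT f ->
  (forall x, `|f x| <= C) -> (forall x, B < `|x| -> f x = 0) ->
  mu.-integrable setT (EFin \o f).
Proof.
move=> mf fC fB.
apply: (lebesgue_dominated mf (integrable_itv_cst (- B) B C)) => x.
case: ifPn => //; rewrite -ler_norml -ltNge => /fB ->; by rewrite normr0.
Qed.

Lemma norm_Rintegral_bounded_supp f (B C : R) : measurable_fun setT f -> 0 <= B ->
  (forall x, `|f x| <= C) -> (forall x, B < `|x| -> f x = 0) ->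
  `|\int[mu]_x f x| <= C * (2 * B).
Proof.
move=> mf B0 fC fB.
apply: (le_trans (lebesgue_norm_le mf (integrable_itv_cst (- B) B C) _)).
  move=> x; case: ifPn => //; rewrite -ler_norml -ltNge => /fB ->; by rewrite normr0.
rewrite Rintegral_itv_cst; lra.
Qed.

End lebesgue_toolkit.

Section affine.
Context {R : realType}.
Local Notation mu := (@lebesgue_measure R).
Variables (c b : R).
Hypothesis c0 : c != 0.
Let aff (x : measurableTypeR R) : measurableTypeR R := c * x + b.

Let maff : measurable_fun setT aff.
Proof. by apply: measurable_funD => //; exact: measurable_funM. Qed.

Let aff_pre x1 x2 : aff @^-1` `]x1, x2] =
  if 0 < c then `](x1 - b) / c, (x2 - b) / c]%classic
  else `[(x2 - b) / c, (x1 - b) / c[%classic.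
Proof.
case: ifPn => [cp|]; last rewrite -leNgt le_eqVlt (negbTE c0) /= => cn.
  apply/seteqP; split=> x /=; rewrite !in_itv/= ltr_pdivrMr// ler_pdivlMr// /aff [x * c]mulrC => /andP[? ?]; apply/andP; split; lra.
apply/seteqP; split=> x /=; rewrite !in_itv/= ltr_ndivlMr// ler_ndivrMr// /aff [x * c]mulrC => /andP[? ?]; apply/andP; split; lra.
Qed.

(** Lebesgue measure is determined by its values on half-open intervals, and
[aff] pulls an interval back to one whose length is divided by [`|c|]. *)
Let affE A : measurable A -> mu A = pushforward (mscale (NngNum (normr_ge0 c)) mu) aff A.
Proof.
move=> mA; apply: lebesgue_measure_unique => // _ [[x1 x2]] _ <-.
rewrite /= /pushforward /mscale /= aff_pre.
case: ifPn => [cp|]; last rewrite -leNgt le_eqVlt (negbTE c0) /= => cn.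
  rewrite !lebesgue_measure_itv/= !lte_fin ltr_pM2r ?invr_gt0// ltrD2r gtr0_norm//.
  case: ifPn => _; last by rewrite mule0.
  by rewrite -!EFinB -EFinM; congr EFin; field.
rewrite !lebesgue_measure_itv/= !lte_fin ltr_nM2r ?invr_lt0// ltrD2r ltr0_norm//.
case: ifPn => _; last by rewrite mule0.
by rewrite -!EFinB -EFinM; congr EFin; field.
Qed.

Lemma null_preimage_affine (N : set (measurableTypeR R)) : measurable N -> mu N = 0%E ->
  measurable [set t : measurableTypeR R | N (c * t + b)] /\
  mu [set t : measurableTypeR R | N (c * t + b)] = 0%E.
Proof.
move=> mN N0; split.
  by have := maff measurableT mN; rewrite setTI.
apply/eqP; have := affE mN; rewrite N0 /pushforward /mscale /= => /esym/eqP.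
by rewrite mule_eq0 eqe normr_eq0 (negbTE c0).
Qed.

Lemma ge0_integral_affine (f : R -> \bar R) : measurable_fun setT f ->
  (forall x, 0 <= f x)%E ->
  (\int[mu]_x f (c * x + b)%R = `|c|^-1%:E * \int[mu]_x f x)%E.
Proof.
move=> mf f0; have cn0 : `|c| != 0 by rewrite normr_eq0.
have mf' : measurable_fun [set: measurableTypeR R] f by [].
have : (\int[mu]_x f x = \int[pushforward (mscale (NngNum (normr_ge0 c)) mu) aff]_x f x)%E.
  by apply: eq_measure_integral => A mA _; exact: affE.
rewrite ge0_integral_pushforward// preimage_setT ge0_integral_mscale//.
- by move=> ->; rewrite /= muleA -EFinM mulVf// mul1e.
- exact: (measurableT_comp mf' maff).
- by move=> x _; exact: f0.
Qed.

Lemma integrable_affine (f : R -> R) : mu.-integrable setT (EFin \o f) ->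
  mu.-integrable setT (EFin \o (fun x => f (c * x + b))).
Proof.
move=> /integrableP[mf foo]; apply/integrableP; split.
  exact: (measurableT_comp mf maff).
rewrite (@ge0_integral_affine (fun x : R => `|(f x)%:E|%E))//; last exact: measurableT_comp.
by rewrite lte_mul_pinfty.
Qed.

Lemma Rintegral_affine (f : R -> R) : mu.-integrable setT (EFin \o f) ->
  \int[mu]_x f (c * x + b) = `|c|^-1 * \int[mu]_x f x.
Proof.
move=> intf; have /integrableP[mf _] := intf.
have intp := integrable_funepos measurableT intf.
have intn := integrable_funeneg measurableT intf.
rewrite /Rintegral integralE [in RHS]integralE.
have mp := measurable_funepos mf; have mn := measurable_funeneg mf.
have Hp := ge0_integral_affine mp (funepos_ge0 _).
have Hn := ge0_integral_affine mn (funeneg_ge0 _).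
have -> : (\int[mu]_x (fun x0 => (f (c * x0 + b))%:E)^\+ x = `|c|^-1%:E * \int[mu]_x (EFin \o f)^\+ x)%E 
  by rewrite -Hp; apply: eq_integral => x _; rewrite !funeposE.
have -> : (\int[mu]_x (fun x0 => (f (c * x0 + b))%:E)^\- x = `|c|^-1%:E * \int[mu]_x (EFin \o f)^\- x)%E 
  by rewrite -Hn; apply: eq_integral => x _; rewrite !funenegE.
rewrite -(fineK (integrable_fin_num measurableT intp)).
rewrite -(fineK (integrable_fin_num measurableT intn)) /=.
by rewrite mulrBr.
Qed.

End affine.

(** Fubini for a bounded kernel supported in the square [-A, A] x [-A, A]: all
the partial integrals exist, not only almost all of them. *)
Section bounded_fubini.
Context {R : realType}.
Local Notation mu := (@lebesgue_measure R).
Variables (F : R -> R -> R) (A C : R).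
Hypothesis A0 : 0 <= A.
Hypothesis mF : measurable_fun setT (fun z : measurableTypeR R * measurableTypeR R => F z.1 z.2).
Hypothesis FC : forall x y, `|F x y| <= C.
Hypothesis FA1 : forall x y, A < `|x| -> F x y = 0.
Hypothesis FA2 : forall x y, A < `|y| -> F x y = 0.

Let mF1 x : measurable_fun [set: R] (F x).
Proof. exact: (measurable_fun_pair2 x mF). Qed.

Let mF2 y : measurable_fun [set: R] (F^~ y).
Proof. exact: (measurable_fun_pair1 y mF). Qed.

Let iF1 x : mu.-integrable setT (EFin \o F x).
Proof. by apply: (@integrable_bounded_supp _ _ A C) => // y /FA2. Qed.

Let iF2 y : mu.-integrable setT (EFin \o F^~ y).
Proof. by apply: (@integrable_bounded_supp _ _ A C) => // x /FA1. Qed.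

Let phi x := if - A <= x <= A then C * (2 * A) else 0.

Let Fphi x : \int[mu]_y `|F x y| <= phi x.
Proof.
rewrite /phi; case: ifPn => [_|]; last first.
  rewrite -ler_norml -ltNge => Ax.
  under eq_Rintegral do rewrite FA1// normr0.
  by rewrite Rintegral_cst// mul0r.
apply: (le_trans (ler_norm _)); apply: norm_Rintegral_bounded_supp => //.
- by apply: measurableT_comp => //; exact: mF1.
- by move=> y; rewrite normr_id.
- by move=> y /FA2 ->; rewrite normr0.
Qed.

Lemma Rintegral_fubini_bounded :
  \int[mu]_x \int[mu]_y F x y = \int[mu]_y \int[mu]_x F x y.
Proof. exact: (Rintegral_fubini mF iF1 iF2 (integrable_itv_cst _ _ _) Fphi). Qed.

Lemma measurable_fubini_bounded : measurable_fun [set: R] (fun x => \int[mu]_y F x y).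
Proof.
have := integrable_fubini1 mF iF1 (integrable_itv_cst _ _ _) Fphi.
by move=> /(@measurable_int _ _ _ _ _ _)/measurable_EFinP.
Qed.

Lemma norm_fubini_bounded x : `|\int[mu]_y F x y| <= C * (2 * A).
Proof. by apply: norm_Rintegral_bounded_supp => // y /FA2. Qed.

End bounded_fubini.

Section set_integrals.
Context {R : realType}.
Local Notation mu := (@lebesgue_measure R).

Lemma measurable_bool_set (b : R -> bool) : measurable_fun [set: R] b -> measurable [set x | b x].
Proof.
move=> mb; have := mb measurableT [set true] I; rewrite setTI.
by congr measurable; apply/seteqP; split => x /=.
Qed.

Lemma integral_bool_set (b : R -> bool) (u : R -> \bar R) :
  (\int[mu]_(x in [set x | b x]) u x = \int[mu]_x (if b x then u x else 0))%E.
Proof.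
rewrite integral_mkcond; apply: eq_integral => x _.
rewrite patchE; case: ifPn => [|/negP xb]; first by rewrite inE /= => ->.
by case: ifPn => // bx; exfalso; apply: xb; rewrite inE.
Qed.

Lemma le_integral_set (A : set R) (u w : R -> R) : measurable A ->
  measurable_fun [set: R] u -> (forall x, 0 <= u x) ->
  mu.-integrable setT (EFin \o w) -> (forall x, 0 <= w x) -> (forall x, A x -> u x <= w x) ->
  (\int[mu]_(x in A) (u x)%:E <= (\int[mu]_x w x)%:E)%E.
Proof.
move=> mA mu' u0 iw w0 uw; rewrite EFin_Rintegral// [leLHS]integral_mkcond.
apply: ge0_le_integral => //.
- by move=> x _; rewrite patchE; case: ifP => //; rewrite lee_fin.
- apply/(measurable_restrictT _ _).1 => //.
  by apply/measurable_EFinP; apply: measurable_funTS.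
- by have /integrableP[] := iw.
- move=> x _; rewrite patchE; case: ifPn => [/set_mem Ax|_]; last by rewrite lee_fin.
  by rewrite lee_fin; exact: uw.
Qed.

End set_integrals.

Section null_sets.
Local Open Scope ereal_scope.
Context d (T : measurableType d) (R : realType) (m : {measure set T -> \bar R}).
Variables (N : set T).
Hypotheses (mN : measurable N) (mN0 : m N = 0).
Import HBNNSimple.

(** A simple function below [u] may be cut off on [N]; this does not change its
integral and puts it below [v]. *)
Let ge0_le_integral_off_null (u v : T -> \bar R) : (forall x, 0 <= u x) -> (forall x, 0 <= v x) ->
  (forall x, ~ N x -> u x = v x) -> \int[m]_x u x <= \int[m]_x v x.
Proof.
move=> u0 v0 uv; rewrite ge0_integralTE//; apply: ge_ereal_sup => _ [h /= hu <-].
have -> : sintegral m h = \int[m]_x (h x)%:E.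
  by rewrite integral_nnsfun// patch_setT.
have mh : measurable_fun setT (EFin \o h) by exact/measurable_EFinP.
rewrite (ge0_negligible_integral mN measurableT mh _ mN0); last by move=> x _; rewrite /= lee_fin.
rewrite setTD integral_mkcond ge0_integralTE; last first.
  by move=> x; rewrite patchE; case: ifP => //; rewrite /= lee_fin.
apply: ge_ereal_sup => _ [k /= kh <-]; rewrite ge0_integralTE//.
apply: ereal_sup_ubound; exists k => // x; apply: (le_trans (kh x)).
rewrite patchE; case: ifPn => // /set_mem Nx.
by rewrite -uv// hu.
Qed.

(** No measurability of [u] or [v]: this is what lets a derivative, which is
only known almost everywhere, be replaced by a Borel density. *)
Lemma integral_off_null (u v : T -> \bar R) :
  (forall x, ~ N x -> u x = v x) -> \int[m]_x u x = \int[m]_x v x.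
Proof.
move=> uv; rewrite integralE [RHS]integralE; congr (_ - _);
  apply/eqP; rewrite eq_le; apply/andP; split; apply: ge0_le_integral_off_null => //;
  by move=> x /uv e; rewrite ?funeposE ?funenegE e.
Qed.

End null_sets.

Section lebesgue_misc.
Context {R : realType}.
Local Notation mu := (@lebesgue_measure R).

Lemma eq_Rintegral_off_point (a : R) (u v : R -> R) : (forall x, x != a -> u x = v x) ->
  \int[mu]_x u x = \int[mu]_x v x.
Proof.
move=> uv; rewrite /Rintegral; congr fine.
apply: (@integral_off_null _ (measurableTypeR R) R mu [set a]).
- exact: measurable_set1.
- exact: lebesgue_measure_set1.
- by move=> x xa; rewrite uv//; apply/eqP.
Qed.

Lemma lipschitz_continuous (f : R -> R) (V : R) :
  (forall x y, `|f x - f y| <= V * `|x - y|) -> continuous f.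
Proof.
move=> fV x; apply/cvgrPdist_le => e e0.
have V0 : 0 <= V.
  have := fV 1 0; rewrite subr0 normr1 mulr1; exact: le_trans.
have d0 : 0 < e / (V + 1) by rewrite divr_gt0// ltr_wpDl.
near=> y; apply: (le_trans (fV _ _)).
have : `|x - y| <= e / (V + 1).
  by near: y; apply: (@cvgr_dist_le _ _ _ _ _ id x) => //; exact: cvg_id.
rewrite ler_pdivlMr ?ltr_wpDl// => h; apply: le_trans h.
rewrite mulrC ler_wpM2l// lerDl//.
Unshelve. all: by end_near. Qed.

Lemma Rintegral_itv_if (f : R -> R) (a b : R) :
  \int[mu]_x (if a <= x <= b then f x else 0) = \int[mu]_(x in `[a, b]) f x.
Proof.
rewrite [RHS]Rintegral_mkcond; apply: eq_Rintegral => x _.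
by rewrite patchE mem_setE in_itv/=; case: ifPn.
Qed.

Lemma Rintegral_derive (F f : R -> R) (a b : R) : a <= b -> continuous f ->
  (forall x, is_derive x (1 : R) F (f x)) ->
  \int[mu]_x (if a <= x <= b then f x else 0) = F b - F a.
Proof.
move=> ab cf dF; rewrite Rintegral_itv_if.
have cF : continuous F.
  by move=> x; apply/differentiable_continuous/derivable1_diffP; case: (dF x).
move: ab; rewrite le_eqVlt => /predU1P[->|ab].
  by rewrite set_itv1 Rintegral_set1 subrr.
rewrite /Rintegral (@continuous_FTC2 _ f F)//.
- exact: continuous_subspaceT.
- split.
  + by move=> x _; case: (dF x).
  + by apply: cvg_at_right_filter; exact: cF.
  + by apply: cvg_at_left_filter; exact: cF.
- by move=> x _; rewrite derive1E derive_val.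
Qed.

End lebesgue_misc.

(** * The conjugate Poisson kernel *)

Section hilbert_kernel.
Context {R : realType}.
Local Notation mu := (@lebesgue_measure R).

(** The conjugate Poisson kernel: a smoothing of [1 / u] at scale [s]. *)
Definition conj_poisson (s u : R) : R := u / (u ^+ 2 + s ^+ 2).

Lemma conj_poisson_den_gt0 (s u : R) : 0 < s -> 0 < u ^+ 2 + s ^+ 2.
Proof. by move=> s0; rewrite ltr_wpDl ?sqr_ge0// exprn_gt0. Qed.

Lemma continuous_conj_poisson (s : R) : 0 < s -> continuous (conj_poisson s).
Proof.
move=> s0 x; apply: cvgM; first exact: cvg_id.
apply: cvgV; first by rewrite gt_eqF// conj_poisson_den_gt0.
by apply: cvgD; [exact: exprn_continuous|exact: cvg_cst].
Qed.

Let is_derive_lnsq (s t x : R) : 0 < s ->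
  is_derive x (1 : R) (fun y => ln ((y - t) ^+ 2 + s ^+ 2)) (2 * conj_poisson s (x - t)).
Proof.
move=> s0; have p := conj_poisson_den_gt0 (x - t) s0.
have H : is_derive x (1 : R) (fun y : R => (y - t) ^+ 2 + s ^+ 2) (2 * (x - t)).
  have -> : (fun y : R => (y - t) ^+ 2 + s ^+ 2) = ((fun y => y - t) ^+ 2 + cst (s ^+ 2)).
    by apply/funext => y.
  apply: is_derive_eq; rewrite /GRing.scale/= subr0; ring.
have := @is_derive1_comp R (@ln R) (fun y : R => (y - t) ^+ 2 + s ^+ 2) x _ _ (is_derive1_ln p) H.
by rewrite /conj_poisson; congr is_derive; rewrite mulrC; ring.
Qed.

Let is_derive_atans (s t x : R) : 0 < s ->
  is_derive x (1 : R) (fun y => atan ((y - t) / s)) (s / ((x - t) ^+ 2 + s ^+ 2)).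
Proof.
move=> s0; have p := conj_poisson_den_gt0 (x - t) s0.
have H : is_derive x (1 : R) (fun y : R => (y - t) / s) (s^-1).
  have -> : (fun y : R => (y - t) / s) = (s^-1 \*: (fun y => y - t)).
    by apply/funext => y; rewrite /= mulrC.
  apply: is_derive_eq; rewrite /GRing.scale/= subr0; ring.
have := @is_derive1_comp R (@atan R) (fun y : R => (y - t) / s) x _ _ (is_derive1_atan ((x - t) / s)) H.
have q : 0 < 1 + ((x - t) / s) ^+ 2 by rewrite ltr_pwDl// sqr_ge0.
congr is_derive; field.
by rewrite !gt_eqF//= addrC.
Qed.

Let ln_diff (x y m : R) : 0 < m -> m <= x -> m <= y -> `|ln x - ln y| <= `|x - y| / m.
Proof.
move=> m0.
have H u v : m <= u -> m <= v -> ln u - ln v <= `|u - v| / m.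
  move=> mu mv; have v0 : 0 < v by exact: lt_le_trans mv.
  have u0 : 0 < u by exact: lt_le_trans mu.
  rewrite -ln_div ?posrE//.
  have -> : u / v = 1 + (u - v) / v by field; rewrite gt_eqF.
  apply: (le_trans (le_ln1Dx _)).
    by rewrite ltr_pdivlMr//; lra.
  rewrite ler_pdivlMr// mulrAC ler_pdivrMr//.
  have n0 : 0 <= `|u - v| := normr_ge0 _.
  have n1 : u - v <= `|u - v| := ler_norm _.
  nra.
move=> mx my; rewrite ler_norml H// lerNl opprB.
by rewrite distrC H.
Qed.

(** The correlation of two translates over the whole line is the Poisson-type
kernel [2 * pi * s / ((t - t') ^+ 2 + 4 * s ^+ 2)], whose integral in [t'] is
bounded independently of [s]: this is the cancellation behind the L2 bound.
Over a window twice as large as the region of [t] and [t'] the loss is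
[6 / B], which is also harmless after integration in [t']. *)
Lemma conj_poisson_correlation (s c B t t' : R) : 0 < s -> 0 < B -> t != t' ->
  `|t - c| <= B -> `|t' - c| <= B ->
  `|\int[mu]_x (if c - 2 * B <= x <= c + 2 * B then conj_poisson s (x - t) * conj_poisson s (x - t') else 0)|
  <= 2 * pi * (s / ((t - t') ^+ 2 + 4 * s ^+ 2)) + 6 / B.
Proof.
move=> s0 B0 tt' tB t'B.
set a := t - t'.
have a0 : a != 0 by rewrite subr_eq0.
have D0 : 0 < a ^+ 2 + 4 * s ^+ 2 by rewrite ltr_wpDl ?sqr_ge0// mulr_gt0// exprn_gt0.
(* Partial fractions: with [v = u + a], the product of [u / (u ^+ 2 + s ^+ 2)]
   and [v / (v ^+ 2 + s ^+ 2)] is [(al * u + be) / (u ^+ 2 + s ^+ 2)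
   + (- al * v + be) / (v ^+ 2 + s ^+ 2)]. *)
pose al := (a ^+ 2 + 2 * s ^+ 2) / (a * (a ^+ 2 + 4 * s ^+ 2)).
pose be := s ^+ 2 / (a ^+ 2 + 4 * s ^+ 2).
pose F (x : R) := (al / 2) * (ln ((x - t) ^+ 2 + s ^+ 2) - ln ((x - t') ^+ 2 + s ^+ 2)) +
  (be / s) * (atan ((x - t) / s) + atan ((x - t') / s)).
have dF x : is_derive x (1 : R) F (conj_poisson s (x - t) * conj_poisson s (x - t')).
  have d1 := is_derive_lnsq t x s0; have d2 := is_derive_lnsq t' x s0.
  have d3 := is_derive_atans t x s0; have d4 := is_derive_atans t' x s0.
  have -> : F = ((al / 2) \*: ((fun y => ln ((y - t) ^+ 2 + s ^+ 2)) - (fun y => ln ((y - t') ^+ 2 + s ^+ 2)))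
    + (be / s) \*: ((fun y => atan ((y - t) / s)) + (fun y => atan ((y - t') / s)))).
    by apply/funext => y.
  apply: is_derive_eq; rewrite /GRing.scale/= /al /be /conj_poisson.
  have p1 := conj_poisson_den_gt0 (x - t) s0; have p2 := conj_poisson_den_gt0 (x - t') s0.
  have e : x - t' = (x - t) + a by rewrite /a; ring.
  move: p1 p2; rewrite e; set u := x - t => p1 p2.
  field; rewrite a0 !(gt_eqF s0, gt_eqF p1, gt_eqF p2, gt_eqF D0)//.
have cf : continuous (fun x => conj_poisson s (x - t) * conj_poisson s (x - t')).
  move=> x; apply: cvgM.
    apply: (@continuous_comp _ _ _ (fun x => x - t) (conj_poisson s)); last exact: continuous_conj_poisson.
    by apply: cvgB; [exact: cvg_id|exact: cvg_cst].
  apply: (@continuous_comp _ _ _ (fun x => x - t') (conj_poisson s)); last exact: continuous_conj_poisson.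
  by apply: cvgB; [exact: cvg_id|exact: cvg_cst].
have cB : c - 2 * B <= c + 2 * B by lra.
rewrite (Rintegral_derive cB cf dF).
(* At an end point of the window [x - t] and [x - t'] have modulus at least
   [B], so the two logarithms nearly cancel. *)
have lnB x : (x = c + 2 * B) \/ (x = c - 2 * B) ->
    `|ln ((x - t) ^+ 2 + s ^+ 2) - ln ((x - t') ^+ 2 + s ^+ 2)| <= `|a| * (6 / B).
  move=> xB.
  have [h1 h2 h3] : [/\ B ^+ 2 <= (x - t) ^+ 2 + s ^+ 2, B ^+ 2 <= (x - t') ^+ 2 + s ^+ 2 &
      `|2 * x - t - t'| <= 6 * B].
    move: tB t'B; rewrite !ler_norml => /andP[? ?] /andP[? ?].
    by case: xB => ->; split; rewrite ?ler_norml; try nra; apply/andP; split; lra.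
  apply: (le_trans (ln_diff _ h1 h2)); first by rewrite exprn_gt0.
  have -> : (x - t) ^+ 2 + s ^+ 2 - ((x - t') ^+ 2 + s ^+ 2) = - a * (2 * x - t - t').
    by rewrite /a; ring.
  rewrite normrM normrN -mulrA ler_wpM2l//.
  by rewrite ler_pdivrMr ?exprn_gt0// expr2 mulrA divfK// gt_eqF.
have al1 : `|al| * `|a| <= 1.
  rewrite -normrM /al.
  have -> : (a ^+ 2 + 2 * s ^+ 2) / (a * (a ^+ 2 + 4 * s ^+ 2)) * a =
     (a ^+ 2 + 2 * s ^+ 2) / (a ^+ 2 + 4 * s ^+ 2) by field; rewrite a0 gt_eqF.
  have := sqr_ge0 a; have := sqr_ge0 s => ? ?.
  rewrite ger0_norm; last by rewrite divr_ge0//; lra.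
  by rewrite ler_pdivrMr//; lra.
have be0 : 0 <= be / s by rewrite !divr_ge0// ?sqr_ge0// ltW.
have bes : be / s = s / (a ^+ 2 + 4 * s ^+ 2).
  by rewrite /be; field; rewrite !gt_eqF.
rewrite -bes /F.
have := lnB _ (or_introl erefl); have := lnB _ (or_intror erefl).
set L1 := ln _ - ln _; set L2 := ln _ - ln _ => HL1 HL2.
have at1 y : `|atan y| <= pi / 2 :> R.
  by rewrite ler_norml ltW ?atan_gtNpi2//= ltW// atan_ltpi2.
move: (at1 ((c + 2 * B - t) / s)) (at1 ((c + 2 * B - t') / s)) (at1 ((c - 2 * B - t) / s)) (at1 ((c - 2 * B - t') / s)).
set A1 := atan _; set A2 := atan _; set A3 := atan _; set A4 := atan _ => HA1 HA2 HA3 HA4.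
have -> : al / 2 * L2 + be / s * (A1 + A2) - (al / 2 * L1 + be / s * (A3 + A4)) =
  be / s * (A1 + A2 - A3 - A4) + al * ((L2 - L1) / 2) by ring.
apply: (le_trans (ler_normD _ _)); apply: lerD.
  rewrite normrM ger0_norm// [leRHS]mulrC ler_wpM2l//.
  move: HA1 HA2 HA3 HA4; rewrite !ler_norml => /andP[? ?] /andP[? ?] /andP[? ?] /andP[? ?].
  by apply/andP; split; lra.
rewrite normrM.
have HL : `|(L2 - L1) / 2| <= `|a| * (6 / B).
  move: HL1 HL2; rewrite !ler_norml => /andP[? ?] /andP[? ?]; apply/andP; split; lra.
have B6 : 0 <= 6 / B by rewrite divr_ge0// ltW.
apply: (le_trans (ler_wpM2l (normr_ge0 al) HL)); rewrite mulrA.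
by have := ler_wpM2r B6 al1; rewrite mul1r.
Qed.

End hilbert_kernel.

Section conjugate_poisson_L2.
Context {R : realType}.
Local Notation mu := (@lebesgue_measure R).

Lemma norm_conj_poisson (s u : R) : 0 < s -> `|conj_poisson s u| <= s^-1.
Proof.
move=> s0; have p := conj_poisson_den_gt0 u s0; rewrite /conj_poisson normrM normfV (gtr0_norm p).
rewrite ler_pdivrMr// mulrC ler_pdivlMr//.
have [u0|u0] := lerP 0 u; [rewrite ger0_norm//|rewrite ltr0_norm//]; nra.
Qed.

Lemma measurable_conj_poisson (s : R) : 0 < s -> measurable_fun [set: R] (conj_poisson s).
Proof. by move=> s0; apply: continuous_measurable_fun; exact: continuous_conj_poisson. Qed.

(** The convolution of [g] with the conjugate Poisson kernel at scale [s]. *)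
Definition conj_poisson_int (s : R) (g : R -> R) (x : R) := \int[mu]_t (g t * conj_poisson s (x - t)).

Lemma Rintegral_poisson (s t a b : R) : 0 < s -> a <= b ->
  \int[mu]_y (if a <= y <= b then s / ((t - y) ^+ 2 + 4 * s ^+ 2) else 0) <= pi / 2.
Proof.
move=> s0 ab.
have s20 : 0 < 2 * s by rewrite mulr_gt0.
have d0 y : 0 < (t - y) ^+ 2 + 4 * s ^+ 2.
  by rewrite ltr_wpDl ?sqr_ge0// mulr_gt0// exprn_gt0.
pose f y := s / ((t - y) ^+ 2 + 4 * s ^+ 2).
pose F (y : R) := 2^-1 * atan ((y - t) / (2 * s)).
have dF (x : R) : is_derive x (1 : R) F (f x).
  have H : is_derive x (1 : R) (fun y : R => (y - t) / (2 * s)) ((2 * s)^-1).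
    have -> : (fun y : R => (y - t) / (2 * s)) = ((2 * s)^-1 \*: (fun y => y - t)).
      by apply/funext => y; rewrite /= mulrC.
    apply: is_derive_eq; rewrite /GRing.scale/= subr0; ring.
  have H2 := @is_derive1_comp R (@atan R) (fun y : R => (y - t) / (2 * s)) x _ _ (is_derive1_atan ((x - t) / (2 * s))) H.
  have -> : F = 2^-1 \*: (@atan R \o (fun y : R => (y - t) / (2 * s))) by apply/funext.
  apply: is_derive_eq; rewrite /GRing.scale/= /f.
  have q : 0 < 1 + ((x - t) / (2 * s)) ^+ 2 by rewrite ltr_pwDl// sqr_ge0.
  have := d0 x => p.
  have e : (1 + ((x - t) / (2 * s)) ^+ 2) = ((t - x) ^+ 2 + 4 * s ^+ 2) / (4 * s ^+ 2).
    by field; rewrite !gt_eqF.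
  rewrite e; field; rewrite !gt_eqF//=.
have cf : continuous f.
  move=> x; apply: cvgM; first exact: cvg_cst.
  apply: cvgV; first by rewrite gt_eqF.
  apply: cvgD; last exact: cvg_cst.
  apply: (@continuous_comp _ _ _ (fun y => t - y) (fun y => y ^+ 2)); last exact: exprn_continuous.
  by apply: cvgB; [exact: cvg_cst|exact: cvg_id].
rewrite (Rintegral_derive ab cf dF) /F.
have := atan_ltpi2 ((b - t) / (2 * s)); have := atan_gtNpi2 ((a - t) / (2 * s)); lra.
Qed.

(** On the diagonal the logarithms of the general case are replaced by the bound
[conj_poisson s u ^+ 2 <= (u ^+ 2 + s ^+ 2)^-1], at the cost of a factor 2. *)
Lemma norm_conj_poisson_correlation (s c B t t' : R) : 0 < s -> 0 < B ->
  `|t - c| <= B -> `|t' - c| <= B ->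
  `|\int[mu]_x (if c - 2 * B <= x <= c + 2 * B then conj_poisson s (x - t) * conj_poisson s (x - t') else 0)|
  <= 4 * pi * (s / ((t - t') ^+ 2 + 4 * s ^+ 2)) + 6 / B.
Proof.
move=> s0 B0 tB t'B; have p0 := pi_ge0 R.
have [<-|tt'] := eqVneq t t'; last first.
  apply: (le_trans (conj_poisson_correlation s0 B0 tt' tB t'B)); rewrite lerD2r.
  have : 0 <= s / ((t - t') ^+ 2 + 4 * s ^+ 2).
    by rewrite divr_ge0 ?ltW// ltr_wpDl ?sqr_ge0// mulr_gt0// exprn_gt0.
  nra.
have cB : c - 2 * B <= c + 2 * B by lra.
pose J x := c - 2 * B <= x <= c + 2 * B.
have h0 : 0 < s / 2 by rewrite divr_gt0.
pose P y := if J y then s / 2 / ((t - y) ^+ 2 + 4 * (s / 2) ^+ 2) else 0.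
have d0 y : 0 < (t - y) ^+ 2 + 4 * (s / 2) ^+ 2.
  by rewrite ltr_wpDl ?sqr_ge0// mulr_gt0// exprn_gt0.
have mJ : measurable_fun [set: R] J by apply: measurable_and; apply: measurable_fun_ler.
have mP : measurable_fun [set: R] P.
  apply: measurable_fun_ifT => //; apply: measurable_funM => //.
  apply: (measurableT_comp measurable_inv_fun); apply: measurable_funD => //.
  by apply: measurable_funX; exact: measurable_funB.
have iP : mu.-integrable setT (EFin \o P).
  apply: (lebesgue_dominated mP (integrable_itv_cst (c - 2 * B) (c + 2 * B) (4 * (s / 2))^-1)) => y.
  rewrite /P /J; case: ifPn => _; last by rewrite normr0.
  rewrite ger0_norm; last by rewrite divr_ge0// ltW.
  rewrite ler_pdivrMr// [leRHS]mulrC ler_pdivlMr ?mulr_gt0//.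
  have := sqr_ge0 (t - y); nra.
have i2P : mu.-integrable setT (EFin \o (fun y => 2 / s * P y)).
  exact: lebesgue_integrableZ.
have mk : measurable_fun [set: R] (fun x => conj_poisson s (x - t)).
  by apply: (measurableT_comp (measurable_conj_poisson s0)); exact: measurable_funB.
apply: (@le_trans _ _ (\int[mu]_y (2 / s * P y))).
  apply: lebesgue_norm_le => //.
    by apply: measurable_fun_ifT => //; exact: measurable_funM.
  move=> x; rewrite /P /J; case: ifPn => _; last by rewrite normr0 mulr0.
  have e : (t - x) ^+ 2 + 4 * (s / 2) ^+ 2 = (x - t) ^+ 2 + s ^+ 2 by field.
  rewrite -expr2 ger0_norm ?sqr_ge0// e /conj_poisson.
  set u := x - t; have q := conj_poisson_den_gt0 u s0.
  have -> : 2 / s * (s / 2 / (u ^+ 2 + s ^+ 2)) = (u ^+ 2 + s ^+ 2) / (u ^+ 2 + s ^+ 2) ^+ 2.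
    by field; rewrite !gt_eqF.
  rewrite expr_div_n ler_pM2r ?invr_gt0 ?exprn_gt0//.
  by rewrite lerDl sqr_ge0.
rewrite RintegralZl//.
have := Rintegral_poisson t h0 cB; rewrite -/(J _) -/(P _) => HP.
have s2 : 0 < 2 / s by rewrite divr_gt0.
apply: (le_trans (ler_wpM2l (ltW s2) HP)).
have -> : 4 * pi * (s / ((t - t) ^+ 2 + 4 * s ^+ 2)) = 2 / s * (pi / 2).
  by rewrite subrr expr0n/= add0r; field; rewrite gt_eqF.
by rewrite lerDl divr_ge0// ltW.
Qed.

Variables (s c B L : R) (g : R -> R).
Hypotheses (s0 : 0 < s) (B0 : 0 < B) (L0 : 0 <= L).
Hypothesis mg : measurable_fun [set: R] g.
Hypothesis gL : forall t, `|g t| <= L.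
Hypothesis gB : forall t, B < `|t - c| -> g t = 0.

Let J x := c - 2 * B <= x <= c + 2 * B.
Let A := `|c| + 2 * B.
Let A0 : 0 <= A. Proof. by rewrite addr_ge0// mulr_ge0// ltW. Qed.

Let k t x := if J x then conj_poisson s (x - t) else 0.

Let mJ : measurable_fun setT (fun z : measurableTypeR R * measurableTypeR R => J z.1).
Proof. by apply: measurable_and; apply: measurable_fun_ler. Qed.

Let JA x : A < `|x| -> J x = false.
Proof.
move=> Ax; apply: contraTF Ax; rewrite /J -leNgt /A => /andP[? ?].
have := ler_norm c; have := ler_norm (- c); have := B0; rewrite normrN => ? ? ?.
rewrite ler_norml; apply/andP; split; lra.
Qed.

Let gA t : A < `|t| -> g t = 0.
Proof.
move=> At; apply: gB; have := ler_normD (t - c) c; rewrite subrK.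
move: At; rewrite /A => ? ?; have := B0; lra.
Qed.

Let kA t x : A < `|x| -> k t x = 0.
Proof. by move=> /JA; rewrite /k => ->. Qed.

Let kC t x : `|k t x| <= s^-1.
Proof. by rewrite /k; case: ifPn => _; [exact: norm_conj_poisson|rewrite normr0 invr_ge0 ltW]. Qed.

Let mk2 : measurable_fun setT (fun z : measurableTypeR R * measurableTypeR R => k z.2 z.1).
Proof.
apply: measurable_fun_ifT => //.
apply: (measurableT_comp (measurable_conj_poisson s0)); exact: measurable_funB.
Qed.

Let T x := \int[mu]_t (g t * k t x).

Let mgk : measurable_fun setT (fun z : measurableTypeR R * measurableTypeR R => g z.2 * k z.2 z.1).
Proof. by apply: measurable_funM => //; exact: (measurableT_comp mg). Qed.

Let gkC x t : `|g t * k t x| <= L * s^-1.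
Proof. by rewrite normrM ler_pM. Qed.

Let mT : measurable_fun [set: R] T.
Proof.
apply: (@measurable_fubini_bounded _ (fun x t => g t * k t x) A (L * s^-1)) => //.
- by move=> x y /kA ->; rewrite mulr0.
- by move=> x y /gA ->; rewrite mul0r.
Qed.

Let TC x : `|T x| <= L * s^-1 * (2 * A).
Proof.
apply: (@norm_fubini_bounded _ (fun x t => g t * k t x)) => // y z.
by move=> /gA ->; rewrite mul0r.
Qed.

Let integrable_gk x : mu.-integrable setT (EFin \o (fun t => g t * k t x)).
Proof.
apply: (@integrable_bounded_supp _ _ A (L * s^-1)) => //.
- exact: (measurable_fun_pair2 x mgk).
- by move=> t /gA ->; rewrite mul0r.
Qed.

Let TE x : T x = if J x then conj_poisson_int s g x else 0.
Proof.
rewrite /T /k; case: ifPn => // _.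
by under eq_Rintegral do rewrite mulr0; rewrite Rintegral_cst// mul0r.
Qed.

Let Q t := \int[mu]_x (T x * k t x).

Let mF t : measurable_fun setT (fun z : measurableTypeR R * measurableTypeR R => g z.2 * k z.2 z.1 * k t z.1).
Proof.
apply: measurable_funM => //.
exact: (measurableT_comp (measurable_fun_pair1 t mk2) measurable_fst).
Qed.

Let FC t x y : `|g y * k y x * k t x| <= L * s^-1 * s^-1.
Proof. by rewrite normrM ler_pM//; exact: gkC. Qed.

Let FE t t' : \int[mu]_x (g t' * k t' x * k t x) = g t' * \int[mu]_x (k t x * k t' x).
Proof.
rewrite -RintegralZl//.
  by apply: eq_Rintegral => x _; rewrite mulrAC -mulrA mulrCA mulrC.
apply: (@integrable_bounded_supp _ _ A (s^-1 * s^-1)).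
+ apply: measurable_funM; exact: (measurable_fun_pair1 _ mk2).
+ by move=> x; rewrite normrM ler_pM.
+ by move=> x /kA ->; rewrite mul0r.
Qed.

(** [Q t] is the value at [t] of the adjoint of [T] applied to [T]; its kernel is
the correlation of the conjugate Poisson kernel. *)
Let QE t : Q t = \int[mu]_t' (g t' * \int[mu]_x (k t x * k t' x)).
Proof.
have -> : Q t = \int[mu]_x \int[mu]_t' (g t' * k t' x * k t x).
  by apply: eq_Rintegral => x _; rewrite -RintegralZr.
rewrite (@Rintegral_fubini_bounded _ (fun x t' => g t' * k t' x * k t x) A (L * s^-1 * s^-1)) => //.
- by apply: eq_Rintegral => t' _; rewrite FE.
- by move=> x y Ax; rewrite (kA t Ax) mulr0.
- by move=> x y /gA ->; rewrite !mul0r.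
Qed.

(** Schur's test: the correlation is integrable in [t'] uniformly in [t], and
[2 * pi ^+ 2 + 12] bounds its integral over an interval of length [2 * B]. *)
Let QC t : `|t - c| <= B -> `|Q t| <= L * (2 * pi ^+ 2 + 12).
Proof.
move=> tB; rewrite QE.
pose I y := c - B <= y <= c + B.
have cB : c - B <= c + B by have := B0; lra.
pose P y := if I y then s / ((t - y) ^+ 2 + 4 * s ^+ 2) else 0.
have d0 y : 0 < (t - y) ^+ 2 + 4 * s ^+ 2.
  by rewrite ltr_wpDl ?sqr_ge0// mulr_gt0// exprn_gt0.
have mI : measurable_fun [set: R] I by apply: measurable_and; apply: measurable_fun_ler.
have mP : measurable_fun [set: R] P.
  apply: measurable_fun_ifT => //; apply: measurable_funM => //.
  apply: (measurableT_comp measurable_inv_fun); apply: measurable_funD => //.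
  by apply: measurable_funX; exact: measurable_funB.
have iP : mu.-integrable setT (EFin \o P).
  apply: (@integrable_bounded_supp _ _ A (4 * s)^-1) => //.
    move=> y; rewrite /P; case: ifPn => _; last by rewrite normr0 invr_ge0 mulr_ge0// ltW.
    rewrite ger0_norm; last by rewrite divr_ge0// ltW.
    rewrite ler_pdivrMr// [leRHS]mulrC ler_pdivlMr ?mulr_gt0//.
    have := sqr_ge0 (t - y); nra.
  move=> y Ay; rewrite /P ifF//; apply: contraTF Ay; rewrite /I -leNgt /A => /andP[? ?].
  have := ler_norm c; have := ler_norm (- c); have := B0; rewrite normrN => ? ? ?.
  rewrite ler_norml; apply/andP; split; lra.
have i6 := integrable_itv_cst (c - B) (c + B) (6 / B).
have iPP : mu.-integrable setT (EFin \o (fun y => 4 * pi * P y)).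
  exact: lebesgue_integrableZ.
pose H y := L * (4 * pi * P y + (if I y then 6 / B else 0)).
have iH : mu.-integrable setT (EFin \o H).
  exact/lebesgue_integrableZ/lebesgue_integrableD.
have Hle t' : `|g t' * \int[mu]_x (k t x * k t' x)| <= H t'.
  rewrite /H /P; case: ifPn => It'; last first.
    rewrite gB ?mul0r ?normr0 ?mulr0 ?addr0 ?mulr0//.
    rewrite ltNge ler_distl; apply: contra It'; rewrite /I; lra.
  rewrite normrM ler_pM// (le_trans _ (norm_conj_poisson_correlation s0 B0 tB _))//; last first.
    by rewrite ler_distl.
  rewrite le_eqVlt; apply/orP; left; apply/eqP; congr `|_|.
  by apply: eq_Rintegral => x _; rewrite /k -/(J x); case: ifPn; rewrite ?mulr0.
have mG : measurable_fun [set: R] (fun t' => g t' * \int[mu]_x (k t x * k t' x)).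
  under eq_fun do rewrite -FE.
  apply: (@measurable_fubini_bounded _ (fun t' x => g t' * k t' x * k t x) A (L * s^-1 * s^-1)) => //.
  + exact: (measurableT_comp (mF t) (@measurable_swap _ _ (measurableTypeR R) (measurableTypeR R))).
  + by move=> x y /gA ->; rewrite !mul0r.
  + by move=> x y Ax; rewrite (kA t Ax) mulr0.
apply: (le_trans (lebesgue_norm_le mG iH Hle)).
rewrite /H RintegralZl//; last first.
  exact: lebesgue_integrableD.
rewrite ler_wpM2l// RintegralD// RintegralZl// Rintegral_itv_cst//.
have HP := Rintegral_poisson t s0 cB; rewrite -/(I _) -/(P _) in HP.
have p0 := pi_ge0 R.
have -> : 6 / B * (c + B - (c - B)) = 12 by field; rewrite gt_eqF.
rewrite lerD2r expr2; nra.
Qed.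

(** The square of the transform is expanded into the pairing of [g] with its
image under the composition of the transform with its adjoint, and that image
is bounded. The bound does not depend on [s]. *)
Lemma conj_poisson_int_L2_bound :
  \int[mu]_x (if c - 2 * B <= x <= c + 2 * B then conj_poisson_int s g x ^+ 2 else 0) <=
  L ^+ 2 * (2 * pi ^+ 2 + 12) * (2 * B).
Proof.
have -> : \int[mu]_x (if c - 2 * B <= x <= c + 2 * B then conj_poisson_int s g x ^+ 2 else 0) =
    \int[mu]_x \int[mu]_t (T x * (g t * k t x)).
  apply: eq_Rintegral => x _; rewrite -/(J x) RintegralZl// -/(T x) TE.
  by case: ifPn => _; rewrite ?mulr0// expr2.
rewrite (@Rintegral_fubini_bounded _ (fun x t => T x * (g t * k t x)) A (L * s^-1 * (2 * A) * (L * s^-1))) => //; first last.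
- by move=> x y /gA ->; rewrite mul0r mulr0.
- by move=> x y Ax; rewrite (kA _ Ax) !mulr0.
- by move=> x y; rewrite normrM ler_pM//; exact: TC.
- by apply: measurable_funM => //; exact: (measurableT_comp mT).
have FQ t : \int[mu]_x (T x * (g t * k t x)) = g t * Q t.
  rewrite /Q -RintegralZl//.
    by apply: eq_Rintegral => x _; rewrite mulrCA.
  apply: (@integrable_bounded_supp _ _ A (L * s^-1 * (2 * A) * s^-1)).
  + apply: measurable_funM => //; exact: (measurable_fun_pair1 _ mk2).
  + by move=> x; rewrite normrM ler_pM//; exact: TC.
  + by move=> x /kA ->; rewrite mulr0.
under eq_Rintegral do rewrite FQ.
have mgQ : measurable_fun [set: R] (fun t => g t * Q t).
  under eq_fun do rewrite -FQ.
  apply: (@measurable_fubini_bounded _ (fun t x => T x * (g t * k t x)) A (L * s^-1 * (2 * A) * (L * s^-1))) => //.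
  + apply: measurable_funM => //; first exact: (measurableT_comp mT).
    exact: (measurableT_comp mgk (@measurable_swap _ _ (measurableTypeR R) (measurableTypeR R))).
  + by move=> x y; rewrite normrM ler_pM//; exact: TC.
  + by move=> x y /gA ->; rewrite mul0r mulr0.
  + by move=> x y Ax; rewrite (kA _ Ax) !mulr0.
have cB : c - B <= c + B by have := B0; lra.
apply: (le_trans (ler_norm _)).
apply: (le_trans (lebesgue_norm_le mgQ (integrable_itv_cst (c - B) (c + B) (L ^+ 2 * (2 * pi ^+ 2 + 12))) _)).
  move=> t; case: ifPn => It; last first.
    rewrite gB ?mul0r ?normr0//.
    by rewrite ltNge ler_distl; exact: It.
  rewrite normrM expr2 -mulrA ler_pM//; apply: QC.
  by rewrite ler_distl.
rewrite Rintegral_itv_cst//.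
by have -> : c + B - (c - B) = 2 * B by ring.
Qed.

End conjugate_poisson_L2.

(** * Cotlar's inequality *)

Section cotlar.
Context {R : realType}.
Local Notation mu := (@lebesgue_measure R).

Lemma integrable_inv_sqr (d t a b : R) : 0 < d ->
  mu.-integrable setT (EFin \o (fun y => if (a <= y <= b) && (d < `|t - y|) then ((t - y) ^+ 2)^-1 else 0)).
Proof.
move=> d0; apply: (lebesgue_dominated _ (integrable_itv_cst a b (d ^+ 2)^-1)).
  apply: measurable_fun_ifT => //.
    apply: measurable_and; first by apply: measurable_and; exact: measurable_fun_ler.
    apply: measurable_fun_ltr => //; apply: measurableT_comp => //; exact: measurable_funB.
  apply: (measurableT_comp measurable_inv_fun).
  by apply: measurable_funX; exact: measurable_funB.
move=> y; case: ifPn => [/andP[-> dy]|_]; last first.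
  by rewrite normr0; case: ifPn => //; rewrite invr_ge0 sqr_ge0.
rewrite ger0_norm ?invr_ge0 ?sqr_ge0// -(real_normK (num_real (t - y))).
by rewrite lef_pV2 ?posrE ?exprn_gt0// ?(lt_trans d0 dy)// ler_pXn2r// ?nnegrE ltW// (lt_trans d0).
Qed.

(** For [d < `|u|] one has [(u ^+ 2)^-1 <= 2 / (u ^+ 2 + d ^+ 2)], which reduces
the tail integral to the Poisson kernel. *)
Lemma Rintegral_inv_sqr (d t a b : R) : 0 < d -> a <= b ->
  \int[mu]_y (if (a <= y <= b) && (d < `|t - y|) then ((t - y) ^+ 2)^-1 else 0) <= 2 * pi / d.
Proof.
move=> d0 ab; have h0 : 0 < d / 2 by rewrite divr_gt0.
pose P y := if a <= y <= b then d / 2 / ((t - y) ^+ 2 + 4 * (d / 2) ^+ 2) else 0.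
have e0 y : 0 < (t - y) ^+ 2 + 4 * (d / 2) ^+ 2.
  by rewrite ltr_wpDl ?sqr_ge0// mulr_gt0// exprn_gt0.
have mP : measurable_fun [set: R] P.
  apply: measurable_fun_ifT => //; first by apply: measurable_and; exact: measurable_fun_ler.
  apply: measurable_funM => //.
  apply: (measurableT_comp measurable_inv_fun); apply: measurable_funD => //.
  by apply: measurable_funX; exact: measurable_funB.
have iP : mu.-integrable setT (EFin \o P).
  apply: (lebesgue_dominated mP (integrable_itv_cst a b (4 * (d / 2))^-1)) => y.
  rewrite /P; case: ifPn => _; last by rewrite normr0.
  rewrite ger0_norm; last by rewrite divr_ge0// ltW.
  rewrite ler_pdivrMr// [leRHS]mulrC ler_pdivlMr ?mulr_gt0//.
  have := sqr_ge0 (t - y); nra.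
apply: (@le_trans _ _ (\int[mu]_y (4 / d * P y))).
  apply: le_Rintegral => //; first exact: integrable_inv_sqr.
    exact: lebesgue_integrableZ.
  move=> y _; rewrite /P; case: (a <= y <= b) => /=; last by rewrite mulr0.
  set u := t - y.
  have -> : 4 / d * (d / 2 / (u ^+ 2 + 4 * (d / 2) ^+ 2)) = 2 / (u ^+ 2 + d ^+ 2).
    by field; have := e0 y; rewrite -/u => ?; rewrite !gt_eqF//= ltr_wpDl ?sqr_ge0// exprn_gt0.
  have q : 0 < u ^+ 2 + d ^+ 2 by rewrite ltr_wpDl ?sqr_ge0// exprn_gt0.
  case: ifPn => [du|_]; last by rewrite divr_ge0// ltW.
  have du2 : d ^+ 2 < u ^+ 2 by rewrite -(real_normK (num_real u)) ltr_pXn2r// ?nnegrE ltW.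
  have u2 : 0 < u ^+ 2 by apply: le_lt_trans du2; exact: sqr_ge0.
  by rewrite ler_pdivlMr// mulrC ler_pdivrMr//; lra.
rewrite RintegralZl//.
have HP := Rintegral_poisson t h0 ab.
have d4 : 0 < 4 / d by rewrite divr_gt0.
apply: (le_trans (ler_wpM2l (ltW d4) HP)).
by rewrite le_eqVlt; apply/orP; left; apply/eqP; field; rewrite gt_eqF.
Qed.

Lemma conj_poisson_lipschitz (s u v : R) : 0 < s -> `|conj_poisson s u - conj_poisson s v| <= (s ^+ 2)^-1 * `|u - v|.
Proof.
move=> s0; have p := conj_poisson_den_gt0 u s0; have q := conj_poisson_den_gt0 v s0.
have -> : conj_poisson s u - conj_poisson s v = (u - v) * ((s ^+ 2 - u * v) / ((u ^+ 2 + s ^+ 2) * (v ^+ 2 + s ^+ 2))).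
  by rewrite /conj_poisson; field; rewrite !gt_eqF.
rewrite normrM mulrC ler_wpM2r// normrM normfV (gtr0_norm (mulr_gt0 p q)).
rewrite ler_pdivrMr ?mulr_gt0// [leRHS]mulrC ler_pdivlMr ?exprn_gt0//.
have h1 : `|s ^+ 2 - u * v| <= s ^+ 2 + (u ^+ 2 + v ^+ 2).
  have := sqr_ge0 (u - v); have := sqr_ge0 (u + v); have := sqr_ge0 s.
  rewrite !expr2 => ? ? ?; rewrite ler_norml; apply/andP; split; nra.
apply: (le_trans (ler_wpM2r (sqr_ge0 s) h1)).
have := mulr_ge0 (sqr_ge0 u) (sqr_ge0 v); lra.
Qed.

(** Far from the origin the kernel neither feels its smoothing nor a shift of its
argument by [e], up to an error that is integrable over [2 * e < `|u|]. *)
Lemma conj_poisson_inv_dist (s e u v : R) : 0 < s -> s <= e -> 2 * e < `|u| -> `|u - v| <= e ->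
  `|u^-1 - conj_poisson s v| <= 4 * e * (u ^+ 2)^-1.
Proof.
move=> s0 se eu uv; have e0 : 0 < e by exact: lt_le_trans se.
have u0 : u != 0 by rewrite -normr_gt0; lra.
have hv : `|u| <= `|v| * 2.
  have := ler_normD (u - v) v; rewrite subrK; lra.
have v0 : 0 < `|v| by lra.
have q := conj_poisson_den_gt0 v s0.
have -> : u^-1 - conj_poisson s v = (v * (v - u) + s ^+ 2) / (u * (v ^+ 2 + s ^+ 2)).
  by rewrite /conj_poisson; field; rewrite gt_eqF.
have un0 : 0 < `|u| by rewrite normr_gt0.
rewrite normrM normfV normrM (gtr0_norm q) ler_pdivrMr ?mulr_gt0//.
have h1 : `|v * (v - u) + s ^+ 2| <= 2 * e * `|v|.
  apply: (le_trans (ler_normD _ _)); rewrite normrM distrC (ger0_norm (sqr_ge0 s)).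
  have : `|v| * `|u - v| <= `|v| * e by rewrite ler_wpM2l.
  have : s ^+ 2 <= e * `|v| by rewrite expr2 ler_pM//; lra.
  lra.
apply: (le_trans h1).
have -> : 4 * e * (u ^+ 2)^-1 * (`|u| * (v ^+ 2 + s ^+ 2)) = 4 * e * (v ^+ 2 + s ^+ 2) / `|u|.
  rewrite -(real_normK (num_real u)); field; exact: lt0r_neq0.
rewrite ler_pdivlMr// -(real_normK (num_real v)).
have s2 := sqr_ge0 s.
have h2 : `|v| * `|u| <= `|v| * (`|v| * 2) by rewrite ler_wpM2l.
rewrite expr2; nra.
Qed.

Variables (B L : R) (g : R -> R).
Hypotheses (B0 : 0 < B) (L0 : 0 <= L).
Hypothesis mg : measurable_fun [set: R] g.
Hypothesis gL : forall t, `|g t| <= L.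
Hypothesis gB : forall t, B < `|t| -> g t = 0.

Definition truncated_hilbert (d x : R) :=
  \int[mu]_t (if d < `|x - t| then g t / (x - t) else 0).

Let integrable_gconj_poisson (s x : R) (h : R -> R) : 0 < s -> measurable_fun [set: R] h ->
  (forall t, `|h t| <= L) -> (forall t, B < `|t| -> h t = 0) ->
  mu.-integrable setT (EFin \o (fun t => h t * conj_poisson s (x - t))).
Proof.
move=> s0 mh hL hB; apply: (@integrable_bounded_supp _ _ B (L * s^-1)).
- apply: measurable_funM => //; apply: (measurableT_comp (measurable_conj_poisson s0)); exact: measurable_funB.
- by move=> t; rewrite normrM ler_pM// norm_conj_poisson.
- by move=> t /hB ->; rewrite mul0r.
Qed.

Let measurable_conj_poisson_int (s : R) (h : R -> R) : 0 < s -> measurable_fun [set: R] h ->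
  (forall t, `|h t| <= L) -> (forall t, B < `|t| -> h t = 0) ->
  measurable_fun [set: R] (conj_poisson_int s h).
Proof.
move=> s0 mh hL hB; apply: continuous_measurable_fun.
apply: (@lipschitz_continuous _ _ (L * (s ^+ 2)^-1 * (2 * B))) => x y.
rewrite /conj_poisson_int -RintegralB//; [|exact: integrable_gconj_poisson|exact: integrable_gconj_poisson].
rewrite mulrAC; apply: norm_Rintegral_bounded_supp.
- apply: measurable_funB.
    by have := integrable_gconj_poisson x s0 mh hL hB; move=> /(@measurable_int _ _ _ _ _ _)/measurable_EFinP.
  by have := integrable_gconj_poisson y s0 mh hL hB; move=> /(@measurable_int _ _ _ _ _ _)/measurable_EFinP.
- exact: ltW.
- move=> t; rewrite -mulrBr normrM -mulrA ler_pM//.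
  apply: (le_trans (conj_poisson_lipschitz _ _ s0)).
  by rewrite (_ : x - t - (y - t) = x - y)//; ring.
- by move=> t /hB ->; rewrite !mul0r subrr.
Qed.

Let norm_conj_poisson_int (s x : R) (h : R -> R) : 0 < s -> measurable_fun [set: R] h ->
  (forall t, `|h t| <= L) -> (forall t, B < `|t| -> h t = 0) ->
  `|conj_poisson_int s h x| <= L * s^-1 * (2 * B).
Proof.
move=> s0 mh hL hB; apply: norm_Rintegral_bounded_supp; last 2 first.
- by move=> t; rewrite normrM ler_pM// norm_conj_poisson.
- by move=> t /hB ->; rewrite mul0r.
- by have := integrable_gconj_poisson x s0 mh hL hB; move=> /(@measurable_int _ _ _ _ _ _)/measurable_EFinP.
- exact: ltW.
Qed.

Lemma integrable_conj_poisson_int_sq (s a b : R) (h : R -> R) : 0 < s -> measurable_fun [set: R] h ->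
  (forall t, `|h t| <= L) -> (forall t, B < `|t| -> h t = 0) ->
  mu.-integrable setT (EFin \o (fun x => if a <= x <= b then conj_poisson_int s h x ^+ 2 else 0)).
Proof.
move=> s0 mh hL hB.
apply: (lebesgue_dominated _ (integrable_itv_cst a b ((L * s^-1 * (2 * B)) ^+ 2))).
  apply: measurable_fun_ifT => //; first by apply: measurable_and; exact: measurable_fun_ler.
  by apply: measurable_funX; exact: measurable_conj_poisson_int.
move=> x; case: ifPn => _; last by rewrite normr0.
have h0 := norm_conj_poisson_int x s0 mh hL hB.
by rewrite normrX ler_pXn2r// ?nnegrE// (le_trans _ h0).
Qed.

Definition cotlar_cst : R := 4 * pi * L + 2 + 2 * (L ^+ 2 * (2 * pi ^+ 2 + 12)).

(** Split [g] into its part near [x], at distance at most [2 * e], and its part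
far from [x]. The truncated transform at [x] is, up to a bounded error, the
smoothed transform of the far part at any [y] within [e] of [x], that is the
smoothed transform of [g] at [y] minus that of the near part. Averaging in
[y], the near part is controlled by the L2 bound on an interval of length
comparable to [e]. Squares instead of absolute values are used on the right,
through [`|p| <= 1 + p ^+ 2], since they have bounded integral. *)
Lemma cotlar (s e x : R) : 0 < s -> s <= e ->
  `|truncated_hilbert (2 * e) x| <= cotlar_cst +
   (2 * e)^-1 * \int[mu]_y (if x - e <= y <= x + e then conj_poisson_int s g y ^+ 2 else 0).
Proof.
move=> s0 se; have e0 : 0 < e by exact: lt_le_trans se.
have e20 : 0 < 2 * e by rewrite mulr_gt0.
pose far t := 2 * e < `|x - t|.
have mfar : measurable_fun [set: R] far.
  apply: measurable_fun_ltr => //; apply: measurableT_comp => //; exact: measurable_funB.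
pose g1 t := if far t then 0 else g t.
pose g2 t := if far t then g t else 0.
have mg1 : measurable_fun [set: R] g1 by exact: measurable_fun_ifT.
have mg2 : measurable_fun [set: R] g2 by exact: measurable_fun_ifT.
have g1L t : `|g1 t| <= L by rewrite /g1; case: ifP; rewrite ?normr0.
have g2L t : `|g2 t| <= L by rewrite /g2; case: ifP; rewrite ?normr0.
have g1B t : B < `|t| -> g1 t = 0 by rewrite /g1; case: ifP => // _ /gB.
have g2B t : B < `|t| -> g2 t = 0 by rewrite /g2; case: ifP => // _ /gB.
set H := truncated_hilbert _ _.
have iH : mu.-integrable setT (EFin \o (fun t => if far t then g t / (x - t) else 0)).
  apply: (@integrable_bounded_supp _ _ B (L * (2 * e)^-1)).
  - apply: measurable_fun_ifT => //; apply: measurable_funM => //.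
    apply: (measurableT_comp measurable_inv_fun); exact: measurable_funB.
  - move=> t; case: ifPn => [ft|_]; last by rewrite normr0 mulr_ge0// invr_ge0 ltW.
    rewrite normrM normfV ler_pM// ?invr_ge0// lef_pV2 ?posrE//; first exact: ltW.
    exact: lt_trans ft.
  - by move=> t /gB ->; rewrite mul0r; case: ifP.
have H2 y : x - e <= y <= x + e -> `|H - conj_poisson_int s g2 y| <= 4 * pi * L.
  move=> xy; rewrite /H /conj_poisson_int /truncated_hilbert -RintegralB//; last exact: integrable_gconj_poisson.
  have BB : - B <= B by have := B0; lra.
  have iS := lebesgue_integrableZ (4 * e * L) (integrable_inv_sqr x (- B) B e20).
  apply: (le_trans (lebesgue_norm_le _ iS _)).
  - apply: measurable_funB.
      by move: iH => /(@measurable_int _ _ _ _ _ _)/measurable_EFinP.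
    by have := integrable_gconj_poisson y s0 mg2 g2L g2B; move=> /(@measurable_int _ _ _ _ _ _)/measurable_EFinP.
  - move=> t; rewrite /g2 -/(far t); case: ifPn => ft; last first.
      by rewrite mul0r subrr normr0 andbF mulr0.
    rewrite andbT; case: ifPn => [_|]; last first.
      by rewrite -ler_norml -ltNge => /gB ->; rewrite !mul0r subrr normr0 mulr0.
    rewrite -mulrBr normrM [4 * e * L]mulrC -mulrA ler_pM//.
    apply: conj_poisson_inv_dist => //.
    rewrite (_ : x - t - (y - t) = x - y); last by ring.
    by rewrite ler_distlC.
  - rewrite RintegralZl//; last exact: integrable_inv_sqr.
    have h4 : 0 <= 4 * e * L by rewrite !mulr_ge0// ltW.
    apply: (le_trans (ler_wpM2l h4 (Rintegral_inv_sqr x e20 BB))).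
    by rewrite le_eqVlt; apply/orP; left; apply/eqP; field; rewrite gt_eqF.
have Hy y : x - e <= y <= x + e ->
    `|H| <= (4 * pi * L + 2) + (conj_poisson_int s g y ^+ 2 + conj_poisson_int s g1 y ^+ 2).
  move=> xy; have := H2 y xy.
  have -> : conj_poisson_int s g2 y = conj_poisson_int s g y - conj_poisson_int s g1 y.
    rewrite /conj_poisson_int -RintegralB//; [|exact: integrable_gconj_poisson|exact: integrable_gconj_poisson].
    by apply: eq_Rintegral => t _; rewrite /g1 /g2; case: ifP; rewrite mul0r ?subr0 ?subrr.
  set p := conj_poisson_int s g y; set q := conj_poisson_int s g1 y => h.
  have hp : `|p| <= 1 + p ^+ 2.
    have := sqr_ge0 (`|p| - 1); rewrite -(real_normK (num_real p)) => ?; have := normr_ge0 p; nra.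
  have hq : `|q| <= 1 + q ^+ 2.
    have := sqr_ge0 (`|q| - 1); rewrite -(real_normK (num_real q)) => ?; have := normr_ge0 q; nra.
  have := ler_normD (H - (p - q)) (p - q); rewrite subrK.
  have := ler_normB p q; lra.
pose I y := x - e <= y <= x + e.
have ab : x - e <= x + e by lra.
have ab2 : x - 2 * (2 * e) <= x + 2 * (2 * e) by lra.
pose X := \int[mu]_y (if I y then conj_poisson_int s g y ^+ 2 else 0).
pose Y := \int[mu]_y (if x - 2 * (2 * e) <= y <= x + 2 * (2 * e) then conj_poisson_int s g1 y ^+ 2 else 0).
have hh : \int[mu]_y (if I y then `|H| else 0) <=
   \int[mu]_y (if I y then (4 * pi * L + 2) else 0) + (X + Y).
  apply: le_lebesgue_add3.
  - exact: integrable_itv_cst.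
  - exact: integrable_itv_cst.
  - exact: integrable_conj_poisson_int_sq.
  - exact: integrable_conj_poisson_int_sq.
  move=> y; case: ifPn => [Iy|_].
    rewrite ifT; first exact: Hy.
    by move: Iy; rewrite /I => /andP[? ?]; apply/andP; split; lra.
  by rewrite !add0r; case: ifP => // _; rewrite sqr_ge0.
have g1c t : 2 * e < `|t - x| -> g1 t = 0.
  by rewrite /g1 /far distrC => ->.
have hY : Y <= L ^+ 2 * (2 * pi ^+ 2 + 12) * (2 * (2 * e)).
  exact: (conj_poisson_int_L2_bound s0 e20 L0 mg1 g1L g1c).
change (`|H| <= cotlar_cst + (2 * e)^-1 * X); move: hh; rewrite (Rintegral_itv_cst _ ab) (Rintegral_itv_cst _ ab).
have -> : x + e - (x - e) = 2 * e by ring.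
move: X Y hY => X Y hY hh.
rewrite -(ler_pM2r e20) [_^-1 * X]mulrC [leRHS]mulrDl mulfVK ?gt_eqF// /cotlar_cst.
move: hY hh; set K := L ^+ 2 * _; lra.
Qed.

End cotlar.

(** * Almost everywhere boundedness of truncated Hilbert transforms *)

Section maximal_hilbert.
Context {R : realType}.
Local Notation mu := (@lebesgue_measure R).

(** A closed interval of radius [e] sits in the open ball of radius [2 * e],
whence the factor 2. *)
Lemma le_average_HL_maximal (h : R -> R) (x e : R) : 0 < e ->
  locally_integrable setT h -> mu.-integrable setT (EFin \o h) -> (forall y, 0 <= h y) ->
  (((2 * e)^-1 * \int[mu]_y (if (x - e <= y <= x + e) then h y else 0))%:E <=
   2%:E * HL_maximal h x)%E.
Proof.
move=> e0 lh ih h0; have e20 : 0 < 2 * e by rewrite mulr_gt0.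
have := ih => /integrableP[/measurable_EFinP mh _].
have H : (iavg h (ball x (2 * e)) <= HL_maximal h x)%E.
  by apply: ereal_sup_ubound => /=; exists (2 * e) => //; rewrite /= in_itv/= e20.
apply: (@le_trans _ _ (2%:E * iavg h (ball x (2 * e)))%E); last by rewrite lee_wpmul2l.
rewrite /iavg lebesgue_measure_ball; last exact: ltW.
have n0 : (2 * e) *+ 2 != 0 by rewrite mulrn_eq0/= gt_eqF.
rewrite inver (negbTE n0) muleA -EFinM.
have -> : 2 * ((2 * e) *+ 2)^-1 = (2 * e)^-1 by rewrite mulr2n; field; rewrite gt_eqF.
rewrite EFinM lee_wpmul2l ?lee_fin ?invr_ge0 ?(ltW e20)//.
have iI : mu.-integrable setT (EFin \o (fun y => if x - e <= y <= x + e then h y else 0)).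
  apply: (lebesgue_dominated _ ih).
    by apply: measurable_fun_ifT => //; apply: measurable_and; exact: measurable_fun_ler.
  by move=> y; case: ifP => _; rewrite ?normr0// ger0_norm.
rewrite EFin_Rintegral// [leRHS]integral_mkcond.
apply: ge0_le_integral => //.
- by move=> y _; case: ifP => _; rewrite lee_fin.
- by have /integrableP[] := iI.
- apply/(measurable_restrictT _ _).1 => //; first exact: measurable_ball.
  by apply/measurable_EFinP; apply: measurable_funTS; exact: measurableT_comp.
- move=> y _; rewrite patchE; case: ifPn => [xy|_]; last first.
    by case: ifP => _ //; rewrite lee_fin.
  rewrite mem_set; first by rewrite lee_fin ler_norm.
  rewrite /ball/=; move: xy => /andP[? ?].
  by rewrite ltr_distl; apply/andP; split; lra.
Qed.

Variables (B L : R) (g : R -> R).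
Hypotheses (B0 : 0 < B) (L0 : 0 <= L).
Hypothesis mg : measurable_fun [set: R] g.
Hypothesis gL : forall t, `|g t| <= L.
Hypothesis gB : forall t, B < `|t| -> g t = 0.

(** The window of [conj_poisson_int_L2_bound] with centre 0, so that [h n] has integral bounded
independently of [n]. *)
Let h (n : nat) (x : R) := if 0 - 2 * B <= x <= 0 + 2 * B then conj_poisson_int n.+1%:R^-1 g x ^+ 2 else 0.

Let s0 (n : nat) : (0 : R) < n.+1%:R^-1. Proof. by rewrite invr_gt0 ltr0n. Qed.

Let ih n : mu.-integrable setT (EFin \o h n).
Proof. exact: (integrable_conj_poisson_int_sq B0 _ _ (s0 n) mg gL gB). Qed.

Let h0 n x : 0 <= h n x. Proof. by rewrite /h; case: ifP => // _; rewrite sqr_ge0. Qed.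

Let lh n : locally_integrable setT (h n).
Proof. by apply: open_integrable_locally; [exact: openT|exact: ih]. Qed.

Let Q : R := L ^+ 2 * (2 * pi ^+ 2 + 12) * (2 * B).

Let hQ n : (\int[mu]_x `|(h n x)%:E| <= Q%:E)%E.
Proof.
under eq_integral do rewrite gee0_abs ?lee_fin//.
rewrite -EFin_Rintegral// lee_fin; apply: (@conj_poisson_int_L2_bound _ _ 0 B L g) => //.
by move=> t; rewrite subr0; exact: gB.
Qed.

Let E (N n : nat) := [set x | (N.+1%:R%:E < HL_maximal (h n) x)%E].

Let mE N n : measurable (E N n).
Proof.
rewrite /E -[X in measurable X]setTI; apply: emeasurable_fun_o_infty => //.
exact: measurable_HL_maximal.
Qed.

Let muE N n : (mu (E N n) <= (3 / N.+1%:R * Q)%:E)%E.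
Proof.
apply: (le_trans (maximal_inequality (lh n) _)); first by rewrite ltr0n.
by rewrite [leRHS]EFinM lee_wpmul2l ?lee_fin ?divr_ge0//; exact: hQ.
Qed.

(** The points where the maximal function of [h n] exceeds [N.+1] for all large
[n]. Passing to the limit inferior of sets lets the smoothing scale tend to 0
while the weak-type bound is preserved, without any limit of the [h n]. *)
Let G N := \bigcup_m \bigcap_(n in [set n | (m <= n)%N]) E N n.

Let mF N m : measurable (\bigcap_(n in [set n | (m <= n)%N]) E N n).
Proof. by apply: bigcap_measurableType => n _; exact: mE. Qed.

Let mG N : measurable (G N).
Proof. by apply: bigcup_measurable => m _; exact: mF. Qed.

Let muG N : (mu (G N) <= (3 / N.+1%:R * Q)%:E)%E.
Proof.
have H := @nondecreasing_cvg_mu _ _ _ mu _ (mF N) (mG N).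
apply: cvge_le (H _); last first.
  move=> m1 m2 m12; apply/subsetPset => x Hx n /= m2n; apply: Hx => /=.
  exact: leq_trans m2n.
near=> m; apply: (le_trans _ (muE N m)); apply: le_measure.
- by rewrite inE; exact: mF.
- by rewrite inE; exact: mE.
by move=> x /(_ m); apply => /=.
Unshelve. all: by end_near. Qed.

(** If the truncated transforms at [x] are unbounded, then for every [N] one of
them, at some scale [d], is so large that Cotlar's inequality forces the
maximal function of [h n] above [N.+1] for every [n] with
[n.+1%:R^-1 <= d / 2]. Such points lie in all the [G N], whose measure tends to 0. *)
Lemma truncated_hilbert_bounded_local :
  {ae mu, forall x : R, `|x| <= B -> exists C : R, forall d : R, 0 < d -> `|truncated_hilbert g d x| <= C}.
Proof.
exists (\bigcap_N G N); split.
- by apply: bigcapT_measurable.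
- apply/eqP; rewrite -measure_le0; apply/lee_addgt0Pr => e e0; rewrite add0e.
  have [N HN] : exists N : nat, 3 * Q / e <= N.+1%:R.
    (* [N] is large enough for the weak-type bound to be below [e]. *)
    exists (Num.trunc (3 * Q / e)); apply: ltW; exact: truncnS_gt.
  apply: (@le_trans _ _ (mu (G N))).
    apply: le_measure; [by rewrite inE; exact: bigcapT_measurable|by rewrite inE; exact: mG|].
    by move=> x /(_ N); apply.
  apply: (le_trans (muG N)); rewrite lee_fin mulrAC ler_pdivrMr ?ltr0n//.
  by move: HN; rewrite ler_pdivrMr// [_%:R * e]mulrC.
- move=> x /= /not_implyP[xB nC] N _.
  move/forallNP : nC => /(_ (cotlar_cst L + 2 * N.+1%:R)) /existsNP[d /not_implyP[d0]].
  move/negP; rewrite -ltNge => hd.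
  pose e := d / 2; have e0 : 0 < e by rewrite divr_gt0.
  have d2 : d = 2 * e by rewrite /e; field.
  have dB : d <= 2 * B.
    rewrite leNgt; apply/negP => Bd; move: hd; rewrite /truncated_hilbert.
    under eq_Rintegral.
      move=> t _; rewrite (_ : (if _ then _ else _) = 0); last first.
        case: ifPn => // dt; rewrite gB ?mul0r//.
        have := ler_normB x t; lra.
      over.
    rewrite Rintegral_cst// mul0r normr0 ltNge => /negP; apply.
    have p1 : 0 <= pi * L by rewrite mulr_ge0// pi_ge0.
    have p2 : 0 <= L ^+ 2 * (2 * pi ^+ 2 + 12).
      by rewrite mulr_ge0 ?sqr_ge0// addr_ge0// mulr_ge0// sqr_ge0.
    have p3 : (0 : R) <= N.+1%:R by rewrite ler0n.
    by rewrite /cotlar_cst; lra.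
  have [m Hm] : exists m : nat, (m.+1%:R^-1 : R) <= e.
    exists (Num.trunc e^-1); rewrite invf_ple ?posrE ?ltr0n//.
    by apply: ltW; exact: truncnS_gt.
  exists m => // n /= mn; rewrite /E /=.
  have sn : (n.+1%:R^-1 : R) <= e.
    by apply: le_trans Hm; rewrite lef_pV2 ?posrE ?ltr0n// ler_nat ltnS.
  have := cotlar B0 L0 mg gL gB x (s0 n) sn; rewrite -d2.
  have -> : \int[mu]_y (if x - e <= y <= x + e then conj_poisson_int n.+1%:R^-1 g y ^+ 2 else 0) =
      \int[mu]_y (if x - e <= y <= x + e then h n y else 0).
    apply: eq_Rintegral => y _; case: ifPn => // /andP[? ?].
    rewrite /h ifT//; move: xB; rewrite ler_norml => /andP[? ?].
    by apply/andP; split; lra.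
  move=> hc.
  have := le_average_HL_maximal x e0 (lh n) (ih n) (h0 n).
  rewrite -d2; set X := d^-1 * _ in hc * => hX.
  have NX : 2 * N.+1%:R < X by lra.
  have : ((2 * N.+1%:R)%:E < 2%:E * HL_maximal (h n) x)%E by apply: lt_le_trans hX.
  by rewrite EFinM lte_pmul2l.
Qed.

End maximal_hilbert.

Theorem truncated_hilbert_bounded (R : realType) (B L : R) (g : R -> R) :
  0 <= L -> measurable_fun [set: R] g -> (forall t, `|g t| <= L) ->
  (forall t, B < `|t| -> g t = 0) ->
  {ae @lebesgue_measure R, forall x : R,
    exists C : R, forall d : R, 0 < d -> `|truncated_hilbert g d x| <= C}.
Proof.
move=> L0 mg gL gB.
have H n : {ae @lebesgue_measure R, forall x : R,
    `|x| <= `|B| + n.+1%:R -> exists C : R, forall d : R, 0 < d -> `|truncated_hilbert g d x| <= C}.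
  have n0 : 0 < `|B| + n.+1%:R by rewrite ltr_wpDl.
  apply: (truncated_hilbert_bounded_local n0 L0 mg gL) => t Bt.
  apply: gB; apply: le_lt_trans Bt.
  by rewrite (le_trans (ler_norm B))// lerDl.
have := ae_foralln H; apply: filterS => x Hx.
apply: (Hx (Num.trunc `|x|)).
rewrite (le_trans (ltW (truncnS_gt _)))// lerDr//.
Qed.

(** * Lipschitz functions as primitives *)

Lemma lipschitz_bound (R : realType) (f : R -> R) : lipschitz f ->
  exists2 L, 0 < L & forall x y, `|f x - f y| <= L * `|x - y|.
Proof.
move=> /pinfty_ex_gt0[L L0 fL]; exists L => // x y.
exact: (fL (x, y)).
Qed.

Lemma function_support_bounded (R : realType) (f : R -> R) :
  compact (function_support f) -> exists2 B, 0 < B & forall x, B < `|x| -> f x = 0.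
Proof.
move=> /compact_bounded/pinfty_ex_gt0[B B0 fB]; exists B => // x Bx.
apply/eqP; apply: contraLR Bx => fx0; rewrite -leNgt.
by apply: fB; apply: subset_closure.
Qed.

Section stieltjes_half.
Context {R : realType}.
Local Notation mu := (@lebesgue_measure R).
Variables (f : R -> R).
Hypothesis f1 : forall x y, `|f x - f y| <= `|x - y|.

(** For a 1-Lipschitz [f] both functions are nondecreasing, and they add up to the
identity; so the Stieltjes measure of each is dominated by Lebesgue measure. *)
Definition half_up (x : R) := (x + f x) / 2.
Definition half_dn (x : R) := (x - f x) / 2.

Let fc : continuous f.
Proof. by apply: (@lipschitz_continuous _ _ 1) => x y; rewrite mul1r. Qed.

Let f_le x y : x <= y -> - (y - x) <= f y - f x <= y - x.
Proof. by move=> xy; rewrite -ler_norml; apply: (le_trans (f1 _ _)); rewrite ger0_norm// subr_ge0. Qed.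

Let up_nd : {homo half_up : x y / x <= y}.
Proof. by move=> x y /[dup] xy /f_le /andP[? ?]; rewrite /half_up; lra. Qed.
Let dn_nd : {homo half_dn : x y / x <= y}.
Proof. by move=> x y /[dup] xy /f_le /andP[? ?]; rewrite /half_dn; lra. Qed.

Let up_rc : right_continuous half_up.
Proof.
apply: right_continuousW => x; apply: cvgM; last exact: cvg_cst.
by apply: cvgD; [exact: cvg_id|exact: fc].
Qed.
Let dn_rc : right_continuous half_dn.
Proof.
apply: right_continuousW => x; apply: cvgM; last exact: cvg_cst.
by apply: cvgB; [exact: cvg_id|exact: fc].
Qed.

HB.instance Definition _ := isCumulative.Build R _ R half_up up_nd up_rc.
HB.instance Definition _ := isCumulative.Build R _ R half_dn dn_nd dn_rc.

Let nu := lebesgue_stieltjes_measure half_up.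
Let nu' := lebesgue_stieltjes_measure half_dn.

Lemma stieltjes_itvoc (F : cumulative R R) (a b : R) : a <= b ->
  lebesgue_stieltjes_measure F `]a, b] = (F b - F a)%:E.
Proof.
move=> ab; rewrite /lebesgue_stieltjes_measure/= /measure_extension/=.
by rewrite measurable_mu_extE/= ?wlength_itv_bnd//; exact: is_ocitv.
Qed.

Let nu_add A : measurable A -> mu A = measure_add nu nu' A.
Proof.
move=> mA; apply: lebesgue_measure_unique => // _ [[a b]] _ <-.
have [ab|ba] := leP a b; last first.
  by rewrite set_itv_ge ?measure0// bnd_simp -leNgt ltW.
transitivity (nu `]a, b] + nu' `]a, b])%E; last by rewrite -measure_addE.
rewrite /nu /nu' !stieltjes_itvoc// lebesgue_measure_itv/= lte_fin.
rewrite -EFinD; case: ltP => [_|ba]; first by rewrite -?EFinB; congr EFin; rewrite /half_up /half_dn; field.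
have -> : a = b by lra.
by rewrite !subrr addr0.
Qed.

Let nu_le A : measurable A -> (nu A <= mu A)%E.
Proof. by move=> mA; rewrite nu_add// measure_addE leeDl. Qed.

Variable n : R.
Let D : set (measurableTypeR R) := `[- n, n].
Let mD : measurable D. Proof. exact: measurable_itv. Qed.

Let nuD_lt : (nu D < +oo)%E.
Proof.
apply: (le_lt_trans (nu_le mD)); rewrite lebesgue_measure_itv/=.
by case: ifPn => // _; rewrite -EFinB ltry.
Qed.

Let nuD := mfrestr mD nuD_lt.

Let nuD_dom : charge_of_finite_measure nuD `<< mu.
Proof.
apply/null_content_dominatesP => A mA A0; apply/eqP.
rewrite -measure_le0 /charge_of_finite_measure/= /mfrestr /mrestr.
apply: (@le_trans _ _ (mu (A `&` D))); first by apply: nu_le; exact: measurableI.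
rewrite -A0; apply: le_measure; rewrite ?inE//; first exact: measurableI.
Qed.

(** The Radon-Nikodym density. Restricting to a bounded interval makes the
Stieltjes measure finite. *)
Lemma half_up_density : exists2 g : R -> R, mu.-integrable setT (EFin \o g) &
  forall a b, - n <= a -> a <= b -> b <= n -> half_up b - half_up a = \int[mu]_(x in `]a, b]) g x.
Proof.
pose g := fine \o Radon_Nikodym (charge_of_finite_measure nuD) mu.
have gE x : (g x)%:E = Radon_Nikodym (charge_of_finite_measure nuD) mu x.
  by rewrite /g /= fineK// Radon_Nikodym_fin_num.
exists g.
  apply: (@eq_integrable _ _ _ _ _ _ (Radon_Nikodym (charge_of_finite_measure nuD) mu)) => //.
    by move=> x _; rewrite /= gE.
  exact: (Radon_Nikodym_integrable nuD_dom).
move=> a b na ab bn; rewrite /Rintegral.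
under eq_integral do rewrite gE.
rewrite -Radon_Nikodym_integral//= /charge_of_finite_measure/= /mfrestr /mrestr.
rewrite setIidl; first by rewrite /nu stieltjes_itvoc.
move=> x /=; rewrite !in_itv/= => /andP[ax xb]; apply/andP; split.
  exact: (le_trans na (ltW ax)).
exact: (le_trans xb bn).
Qed.

End stieltjes_half.

Section clamp.
Context {R : realType}.
Variables (B c : R).
Hypotheses (B0 : 0 < B) (Bc : B < c).

Definition clamp (x : R) : R := if x < - c then - c else if c < x then c else x.

Lemma clamp_ge x : - c <= clamp x.
Proof.
have b0 := B0; have bc := Bc.
by rewrite /clamp; case: ltP => h1; [|case: ltP => h2]; lra.
Qed.

Lemma clamp_le x : clamp x <= c.
Proof.
have b0 := B0; have bc := Bc.
by rewrite /clamp; case: ltP => h1; [|case: ltP => h2]; lra.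
Qed.

Lemma clamp_homo : {homo clamp : a b / a <= b}.
Proof.
move=> a b ab; have b0 := B0; have bc := Bc.
rewrite /clamp; case: (ltP a) => h1; [|case: (ltP c a) => h2];
  (case: (ltP b) => h3; [|case: (ltP c b) => h4]); lra.
Qed.

Lemma le_clampl a y : `|y| <= B -> (clamp a <= y) = (a <= y).
Proof.
rewrite ler_norml => /andP[y1 y2]; have bc := Bc; rewrite /clamp.
by case: ltP => h1; [|case: ltP => h2]; apply/idP/idP => ?; lra.
Qed.

Lemma le_clampr b y : `|y| <= B -> (y <= clamp b) = (y <= b).
Proof.
rewrite ler_norml => /andP[y1 y2]; have bc := Bc; rewrite /clamp.
by case: ltP => h1; [|case: ltP => h2]; apply/idP/idP => ?; lra.
Qed.

(** Moving a point into [-c, c] does not change a function supported in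
[-B, B]. *)
Lemma clamp_out (f : R -> R) x : (forall y, B < `|y| -> f y = 0) -> f (clamp x) = f x.
Proof.
move=> fB; have b0 := B0; have bc := Bc; rewrite /clamp; case: ltP => [h|h].
  by rewrite !fB// ltr0_norm; lra.
by case: ltP => // h'; rewrite !fB// gtr0_norm; lra.
Qed.

End clamp.

Section lipschitz_density.
Context {R : realType}.
Local Notation mu := (@lebesgue_measure R).
Variables (f : R -> R) (L B : R).
Hypotheses (L0 : 0 < L) (B0 : 0 < B).
Hypothesis fL : forall x y, `|f x - f y| <= L * `|x - y|.
Hypothesis fB : forall x, B < `|x| -> f x = 0.

Lemma derive1_lipschitz_le (x : R) : derivable f x 1 -> `|derive1 f x| <= L.
Proof.
move=> df; rewrite derive1E.
have H : h^-1 *: (f (h *: (1 : R) + x) - f x) @[h --> 0^'] --> 'D_1 f x by exact: df.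
have H' : `|h^-1 *: (f (h *: (1 : R) + x) - f x)| @[h --> 0^'] --> `|'D_1 f x| by exact: cvg_norm.
apply: (cvgr_to_le H').
near=> h.
have h0 : h != 0 by near: h; exact: nbhs_dnbhs_neq.
rewrite normrM normfV ler_pdivrMl ?normr_gt0// mulrC.
by apply: (le_trans (fL _ _)); rewrite /= addrK /GRing.scale/= mulr1.
Unshelve. all: by end_near. Qed.

Lemma derive1_out_support (x : R) : B < `|x| -> derive1 f x = 0.
Proof.
move=> Bx; rewrite derive1E; transitivity ('D_1 (cst 0 : R -> R) x); last exact: derive_cst.
apply: near_eq_derive.
near=> y; apply: fB; near: y.
have H : (fun y : R => `|y|) @ x --> `|x| by apply: cvg_norm; exact: cvg_id.
exact: (cvgr_gt _ H _ Bx).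
Unshelve. all: by end_near. Qed.

(** A Lipschitz function is the primitive of a bounded Borel function that agrees
almost everywhere with its derivative. After rescaling to Lipschitz constant 1,
the Stieltjes measure of [(x + f x) / 2] has a density, and Lebesgue's
differentiation theorem identifies that density with the derivative. The
density is truncated to satisfy its bound and support condition everywhere. *)
Theorem lipschitz_density : exists g : R -> R,
  [/\ measurable_fun [set: R] g, forall x, `|g x| <= L,
      forall x, B < `|x| -> g x = 0,
      forall a b, a <= b -> f b - f a = \int[mu]_y (if a <= y <= b then g y else 0) &
      {ae mu, forall x, derive1 f x = g x}].
Proof.
pose f1 x := f x / L.
have f11 x y : `|f1 x - f1 y| <= `|x - y|.
  rewrite /f1 -mulrBl normrM normfV (gtr0_norm L0) ler_pdivrMr// mulrC; exact: fL.
pose n := B + 2.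
have [g1 ig1 g1E] := half_up_density f11 n.
pose G x := \int[mu]_(t in `]-oo, x]) g1 t.
have ig1S (A : set R) : measurable A -> mu.-integrable A (EFin \o g1).
  by move=> mA; apply: integrableS ig1.
have locg1 : locally_integrable setT g1.
  by apply: open_integrable_locally => //; exact: openT.
have ae1 := FTC1Ny (fun y => ig1S _ (measurable_itv `]-oo, y])) locg1.
pose g x := if (`|x| <= B) && (`|L * (2 * g1 x - 1)| <= L) then L * (2 * g1 x - 1) else 0.
have mg1 : measurable_fun [set: R] g1.
  by have /integrableP[/measurable_EFinP] := ig1.
have mg0 : measurable_fun [set: R] (fun x => L * (2 * g1 x - 1)).
  by apply: measurable_funM => //; apply: measurable_funB => //; exact: measurable_funM.
have mg : measurable_fun [set: R] g.
  apply: measurable_fun_ifT => //; apply: measurable_and; apply: measurable_fun_ler => //.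
  by apply: measurableT_comp.
have GE a b : - n <= a -> a <= b -> b <= n -> f b - f a = L * (2 * (G b - G a) - (b - a)).
  move=> na ab bn; have := g1E a b na ab bn.
  have -> : \int[mu]_(x in `]a, b]) g1 x = G b - G a.
    rewrite /G (@Rintegral_itvB _ _ -oo%O (BRight b) a)//.
    exact: ig1S.
  by move=> <-; rewrite /half_up /f1; field; rewrite gt_eqF.
have der x : derivable G x 1 /\ derive1 G x = g1 x -> - n < x < n ->
    derivable f x 1 /\ derive1 f x = L * (2 * g1 x - 1).
  move=> [dG G'] /andP[nx xn].
  have iG : is_derive x (1 : R) G (g1 x) by rewrite -G' derive1E; exact: DeriveDef.
  pose f2 := cst (f (- n)) + L \*: ((2 : R) \*: (G - cst (G (- n))) - (id - cst (- n))).
  have if2 : is_derive x (1 : R) f2 (L * (2 * g1 x - 1)).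
    by apply: is_derive_eq; rewrite /GRing.scale/=; ring.
  have iff : is_derive x (1 : R) f (L * (2 * g1 x - 1)).
    apply: near_eq_is_derive if2; near=> y.
    have yn : - n <= y <= n.
      apply/andP; split; apply: ltW.
        by near: y; exact: lt_nbhsr.
      by near: y; exact: lt_nbhsl.
    move: yn => /andP[ny yn]; have nn : - n <= - n by [].
    have := GE _ _ nn ny yn; rewrite /f2 /= /GRing.scale/= => e.
    rewrite -[RHS](subrK (f (- n))) e addrC.
    by [].
  by split; [case: iff|rewrite derive1E derive_val].
have aeg : {ae mu, forall x, derive1 f x = g x}.
  move: ae1; apply: filterS; first exact: (ae_filter_ringOfSetsType mu).
  move=> x Hx.
  have [xB|Bx] := leP `|x| B; last first.
    by rewrite derive1_out_support// /g leNgt Bx.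
  have nx : - n < x < n by rewrite -ltr_norml (le_lt_trans xB)// /n ltrDl.
  have [df dfE] := der x Hx nx.
  by rewrite /g xB -dfE derive1_lipschitz_le.
have gB x : B < `|x| -> g x = 0 by rewrite /g leNgt => ->.
exists g; split => //.
- by move=> x; rewrite /g; case: ifPn => [/andP[]//|_]; rewrite normr0 ltW.
pose h (a b y : R) := if a <= y <= b then L * (2 * g1 y - 1) else 0.
have mI (a b : R) : measurable_fun [set: R] (fun y => a <= y <= b).
  by apply: measurable_and; exact: measurable_fun_ler.
have loc a b : - (B + 1) <= a -> a <= b -> b <= B + 1 ->
    f b - f a = \int[mu]_y (if a <= y <= b then g y else 0).
  move=> Ba ab bB.
  have -> : \int[mu]_y (if a <= y <= b then g y else 0) = \int[mu]_y (h a b y).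
    rewrite /Rintegral; congr fine; apply: ae_eq_integral => //.
    - by apply/measurable_EFinP; apply: (measurable_fun_ifT (mI a b) mg).
    - by apply/measurable_EFinP; apply: (measurable_fun_ifT (mI a b) mg0).
    - move: aeg; apply: filterS2 ae1; first exact: (ae_filter_ringOfSetsType mu).
      move=> x Hx gx _; rewrite /h; case: ifPn => // /andP[ax xb].
      have nx : - n < x < n by rewrite /n; apply/andP; split; lra.
      by have [_ <-] := der x Hx nx; rewrite gx.
  have ii : mu.-integrable setT (EFin \o (fun y => if a <= y <= b then g1 y else 0)).
    have ig1n : mu.-integrable setT (EFin \o (fun y => `|g1 y|)) by exact: integrable_norm.
    apply: (lebesgue_dominated _ ig1n); first exact: measurable_fun_ifT.
    by move=> y; rewrite /=; case: ifP => _; rewrite ?normr0.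
  have -> : \int[mu]_y h a b y = \int[mu]_y (2 * L * (if a <= y <= b then g1 y else 0) - (if a <= y <= b then L else 0)).
    apply: eq_Rintegral => y _; rewrite /h; case: ifP => _; ring.
  rewrite RintegralB//; [|exact: lebesgue_integrableZ|exact: integrable_itv_cst].
  rewrite RintegralZl// Rintegral_itv_cst// Rintegral_itv_if.
  rewrite -Rintegral_itv_obnd_cbnd; last exact: ig1S.
  have na : - n <= a by rewrite /n; lra.
  have bn : b <= n by rewrite /n; lra.
  by rewrite -(g1E a b na ab bn) /half_up /f1; field; rewrite gt_eqF.
move=> a b ab.
(* [loc] covers the segments inside [-(B + 1), B + 1]; outside [-B, B] both
   sides are constant in each endpoint, so the endpoints can be clamped. *)
have B1 : B < B + 1 by rewrite ltrDl.
rewrite -(clamp_out B0 B1 b fB) -(clamp_out B0 B1 a fB) loc; last 3 first.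
- exact: (clamp_ge B0 B1).
- exact: (clamp_homo B0 B1).
- exact: (clamp_le B0 B1).
apply: eq_Rintegral => y _.
have [yB|By] := leP `|y| B; last by rewrite (gB _ By) !if_same.
by rewrite (le_clampl B1 a yB) (le_clampr B1 b yB).
Unshelve. all: by end_near. Qed.

End lipschitz_density.

(** * Kernels [Phi t / t] with [Phi] Lipschitz of compact support *)

Section cz_kernel.
Context {R : realType}.
Local Notation mu := (@lebesgue_measure R).
Variables (Phi : R -> R) (V M : R).
Hypotheses (V0 : 0 <= V) (M0 : 0 < M).
Hypothesis PhiV : forall x y, `|Phi x - Phi y| <= V * `|x - y|.
Hypothesis PhiM : forall x, M <= `|x| -> Phi x = 0.

Definition quotient_kernel (t : R) : R := Phi t / t.
Local Notation K := quotient_kernel.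

(** Compare with the end point of the support on the same side of 0. *)
Lemma norm_lipschitz_supp t : `|Phi t| <= V * M.
Proof.
have [tM|] := leP M `|t|; first by rewrite PhiM// normr0 mulr_ge0// ltW.
rewrite ltr_norml => /andP[t1 t2].
have [t0|t0] := lerP 0 t.
  have := PhiV t M; rewrite [Phi M]PhiM ?subr0; last by rewrite ger0_norm// ltW.
  move=> h; apply: (le_trans h); rewrite ler_wpM2l// ler_norml; apply/andP; split; lra.
have := PhiV t (- M); rewrite [Phi (- M)]PhiM ?subr0; last by rewrite normrN ger0_norm// ltW.
move=> h; apply: (le_trans h); rewrite ler_wpM2l// ler_norml; apply/andP; split; lra.
Qed.

Let mPhi : measurable_fun [set: R] Phi.
Proof. by apply: continuous_measurable_fun; exact: lipschitz_continuous PhiV. Qed.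

Lemma measurable_quotient_kernel : measurable_fun [set: R] K.
Proof. by apply: measurable_funM => //; exact: measurable_inv_fun. Qed.
Let mK := measurable_quotient_kernel.

Lemma quotient_kernel_bound r t : 0 < r -> r <= `|t| -> `|K t| <= V * M / r.
Proof.
move=> r0 rt; rewrite normrM normfV ler_pM// ?invr_ge0//; first exact: norm_lipschitz_supp.
by rewrite lef_pV2 ?posrE//; exact: lt_le_trans rt.
Qed.

Lemma quotient_kernel_supp t : M <= `|t| -> K t = 0.
Proof. by move=> tM; rewrite /quotient_kernel PhiM// mul0r. Qed.

(** Write the difference as [(Phi (x - y) - Phi x) / x] plus
[Phi (x - y) * (y / (x * (x - y)))]. Both kernels vanish for [2 * M < `|x|],
and for smaller [x] the first term, of size [V * `|y| / `|x|], is as good as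
the second. *)
Lemma quotient_kernel_hormander x y : y != 0 -> 2 * `|y| <= `|x| ->
  `|K (x - y) - K x| <= 4 * V * M * `|y| *
     (if (- (2 * M) <= x <= 2 * M) && (`|y| < `|0 - x|) then ((0 - x) ^+ 2)^-1 else 0).
Proof.
move=> y0 xy; have yp : 0 < `|y| by rewrite normr_gt0.
have xp : 0 < `|x| by lra.
have x0 : x != 0 by rewrite -normr_gt0.
have hxy : `|x| <= `|x - y| * 2.
  have := ler_normD (x - y) y; rewrite subrK; lra.
have xyp : 0 < `|x - y| by lra.
have xy0 : x - y != 0 by rewrite -normr_gt0.
rewrite -ler_norml; have [xM|Mx] := leP `|x| (2 * M); last first.
  rewrite !quotient_kernel_supp; [by rewrite subrr normr0 mulr0|lra|lra].
rewrite sub0r normrN sqrrN /= ifT; last by lra.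
have -> : K (x - y) - K x = (Phi (x - y) - Phi x) / x + Phi (x - y) * (y / (x * (x - y))).
  by rewrite /quotient_kernel; field; rewrite x0 xy0.
have h1 : `|(Phi (x - y) - Phi x) / x| <= 2 * V * M * `|y| * (x ^+ 2)^-1.
  rewrite normrM normfV.
  have := PhiV (x - y) x; rewrite (_ : x - y - x = - y) ?normrN; last by ring.
  move=> h; apply: (@le_trans _ _ (V * `|y| * `|x|^-1)).
    by rewrite ler_wpM2r// invr_ge0.
  rewrite ler_pdivrMr// -(real_normK (num_real x)).
  have -> : 2 * V * M * `|y| * (`|x| ^+ 2)^-1 * `|x| = 2 * M * (V * `|y|) / `|x|.
    by field; rewrite gt_eqF.
  by rewrite ler_pdivlMr// mulrC ler_wpM2r// mulr_ge0.
have h2 : `|Phi (x - y) * (y / (x * (x - y)))| <= 2 * V * M * `|y| * (x ^+ 2)^-1.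
  rewrite !normrM normfV normrM.
  have -> : 2 * V * M * `|y| * (x ^+ 2)^-1 = (V * M) * (`|y| * (2 / (`|x| ^+ 2))).
    by rewrite real_normK ?num_real//; field.
  rewrite ler_pM ?norm_lipschitz_supp ?mulr_ge0 ?invr_ge0 ?mulr_ge0//.
  rewrite ler_wpM2l// ler_pdivlMr ?exprn_gt0// mulrC ler_pdivrMr ?mulr_gt0//.
  rewrite expr2; have := ler_wpM2l (ltW xp) hxy; lra.
apply: (le_trans (ler_normD _ _)).
have -> : 4 * V * M * `|y| / x ^+ 2 = 2 * V * M * `|y| * (x ^+ 2)^-1 + 2 * V * M * `|y| * (x ^+ 2)^-1 by ring.
exact: lerD.
Qed.

Let measurable_shell (r1 r2 : R) : measurable [set x : R | r1 <= `|x| <= r2].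
Proof.
apply: measurable_bool_set; apply: measurable_and; apply: measurable_fun_ler => //; exact: measurableT_comp.
Qed.

(** The sum of the values at [x] and [- x] is [(Phi x - Phi (- x)) / x], which
the Lipschitz condition bounds. *)
Lemma quotient_kernel_cancel r1 r2 : 0 < r1 ->
  `|\int[mu]_x (if r1 <= `|x| <= r2 then K x else 0)| <= 2 * V * M.
Proof.
move=> r10; pose k x := if r1 <= `|x| <= r2 then K x else 0.
have mk : measurable_fun [set: R] k.
  apply: measurable_fun_ifT => //.
  apply: measurable_and; apply: measurable_fun_ler => //; exact: measurableT_comp.
have ik : mu.-integrable setT (EFin \o k).
  apply: (@integrable_bounded_supp _ _ M (V * M / r1)) => //.
    move=> x; rewrite /k; case: ifPn => [/andP[h _]|_]; first exact: quotient_kernel_bound.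
    by rewrite normr0 divr_ge0 ?mulr_ge0// ltW.
  by move=> x Mx; rewrite /k quotient_kernel_supp ?if_same// ltW.
have N10 : (-1 : R) != 0 by rewrite oppr_eq0 oner_eq0.
have ikN := integrable_affine 0 N10 ik.
have := Rintegral_affine 0 N10 ik; rewrite normrN1 invr1 mul1r => kN.
have -> : \int[mu]_x k x = 2^-1 * \int[mu]_x (k x + k (-1 * x + 0)).
  by rewrite RintegralD// kN; field.
rewrite normrM ger0_norm ?invr_ge0// mulrC ler_pdivrMr//.
have -> : 2 * V * M * 2 = 2 * V * (2 * M) by ring.
apply: norm_Rintegral_bounded_supp.
- apply: measurable_funD => //.
  by have /integrableP[/measurable_EFinP] := ikN.
- exact: ltW.
- move=> x; rewrite mulN1r addr0 /k normrN; case: ifPn => [/andP[xr _]|_]; last first.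
    by rewrite addr0 normr0 mulr_ge0.
  have xp : 0 < `|x| by exact: lt_le_trans xr.
  have x0 : x != 0 by rewrite -normr_gt0.
  rewrite /quotient_kernel invrN mulrN -mulrBl normrM normfV ler_pdivrMr//.
  apply: (le_trans (PhiV _ _)).
  have -> : x - - x = 2 * x by ring.
  by rewrite normrM ger0_norm// mulrA [V * 2]mulrC.
- move=> x /ltW Mx; rewrite mulN1r addr0 /k normrN.
  rewrite (quotient_kernel_supp Mx) (@quotient_kernel_supp (- x)) ?normrN//.
  by case: ifP => _; rewrite addr0.
Qed.

Theorem quotient_kernel_cz : calderon_zygmund_kernel K.
Proof.
have mnK : measurable_fun [set: R] (fun x => `|K x|) by exact: measurableT_comp.
split.
- split.
  + exact: measurable_funTS.
  + by apply: closed_openC; exact: closed_eq.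
  + move=> A A0 cA.
    have [Bd Bd0 AB] := pinfty_ex_gt0 (compact_bounded cA).
    have [r r0 Ar] : exists2 r, 0 < r & forall x, A x -> r <= `|x|.
      have /open_subball : open (~` A) by apply: closed_openC; exact: (compact_closed (@Rhausdorff R)).
      have nA0 : (~` A) 0 by move=> /A0 /=.
      move=> /(_ _ nA0)[e /= e0 He]; exists (e / 2); first by rewrite divr_gt0.
      move=> x Ax; rewrite leNgt; apply/negP => xe.
      have e2 : 0 < e / 2 by rewrite divr_gt0.
      apply: (He (e / 2) _ e2 x _ Ax); rewrite /ball/=.
        by rewrite sub0r normrN gtr0_norm//; lra.
      by rewrite sub0r normrN.
    apply: (@le_lt_trans _ _ (\int[mu]_x (if - Bd <= x <= Bd then V * M / r else 0))%:E); last by rewrite ltry.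
    have c0 : 0 <= V * M / r by rewrite divr_ge0 ?mulr_ge0// ltW.
    apply: le_integral_set => //.
    * exact: compact_measurable.
    * exact: integrable_itv_cst.
    * by move=> x; case: ifP.
    * move=> x Ax; rewrite -ler_norml (AB _ Ax); apply: quotient_kernel_bound => //; exact: Ar.
- apply: (@le_lt_trans _ _ (4 * V * M)%:E); last by rewrite ltry.
  apply: ge_ereal_sup => _ [r /= r0 <-].
  have c0 : 0 <= V * M / r by rewrite divr_ge0 ?mulr_ge0// ltW.
  have r2 : - (2 * r) <= 2 * r by lra.
  have -> : (4 * V * M) = \int[mu]_x (if - (2 * r) <= x <= 2 * r then V * M / r else 0).
    by rewrite Rintegral_itv_cst//; field; rewrite gt_eqF.
  apply: le_integral_set => //.
  + exact: integrable_itv_cst.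
  + by move=> x; case: ifP.
  + move=> x /= /andP[h1 h2]; rewrite -ler_norml h2; exact: quotient_kernel_bound.
- apply: (@le_lt_trans _ _ (8 * pi * V * M)%:E); last by rewrite ltry.
  apply: ge_ereal_sup => _ [y /= y0 <-].
  have yp : 0 < `|y| by rewrite normr_gt0.
  have MM : - (2 * M) <= 2 * M by have := M0; lra.
  have c0 : 0 <= 4 * V * M * `|y| by rewrite !mulr_ge0// ltW.
  have iS := integrable_inv_sqr 0 (- (2 * M)) (2 * M) yp.
  apply: (@le_trans _ _ (\int[mu]_x (4 * V * M * `|y| *
     (if (- (2 * M) <= x <= 2 * M) && (`|y| < `|0 - x|) then ((0 - x) ^+ 2)^-1 else 0)))%:E).
    apply: le_integral_set => //.
    + apply: measurable_bool_set; apply: measurable_fun_ler => //; exact: measurableT_comp.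
    + apply: measurableT_comp => //; apply: measurable_funB => //.
      by apply: (measurableT_comp mK); exact: measurable_funB.
    + exact: lebesgue_integrableZ.
    + by move=> x; rewrite mulr_ge0//; case: ifP => //; rewrite invr_ge0 sqr_ge0.
    + by move=> x /= h; exact: quotient_kernel_hormander.
  rewrite lee_fin RintegralZl//.
  apply: (le_trans (ler_wpM2l c0 (Rintegral_inv_sqr 0 yp MM))).
  by rewrite le_eqVlt; apply/orP; left; apply/eqP; field; rewrite gt_eqF.
- apply: (@le_lt_trans _ _ (2 * V * M)%:E); last by rewrite ltry.
  apply: ge_ereal_sup => _ [[r1 r2] /= /andP[r10 r12] <-].
  rewrite integral_bool_set.
  have mk : measurable_fun [set: R] (fun x => if r1 <= `|x| <= r2 then K x else 0).
    apply: measurable_fun_ifT => //.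
    apply: measurable_and; apply: measurable_fun_ler => //; exact: measurableT_comp.
  under eq_integral do rewrite -(fun_if EFin).
  rewrite -EFin_Rintegral; last first.
    apply: (@integrable_bounded_supp _ _ M (V * M / r1)) => //.
      move=> x; case: ifPn => [/andP[h _]|_]; first exact: quotient_kernel_bound.
      by rewrite normr0 divr_ge0 ?mulr_ge0// ltW.
    by move=> x Mx; rewrite quotient_kernel_supp ?if_same// ltW.
  by rewrite lee_fin; exact: quotient_kernel_cancel.
Qed.

End cz_kernel.

(** * Integration by parts against a charge *)

Section tail_representation.
Context {R : realType}.
Local Notation mu := (@lebesgue_measure R).
Variables (m : {finite_measure set (measurableTypeR R) -> \bar R}) (M : R).
Hypothesis M0 : 0 < M.
Hypothesis mM : m (~` `]- M, M[) = 0%E.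

(** As a function of [v], the density against which the derivative of a test
function is integrated when integrating by parts. *)
Definition tail_mass (v : R) : R := fine (m `[v, +oo[%classic).

Let m_fin A : measurable A -> m A \is a fin_num.
Proof. by move=> mA; exact: fin_num_measure. Qed.

Lemma tail_mass_ge0 v : 0 <= tail_mass v.
Proof. by apply: fine_ge0. Qed.

Lemma tail_mass_le v : tail_mass v <= fine (m setT).
Proof.
apply: fine_le; [exact: m_fin|exact: m_fin|].
by apply: le_measure; rewrite ?inE.
Qed.

Lemma measurable_tail_mass : measurable_fun [set: R] tail_mass.
Proof.
apply: nonincreasing_measurable => // x y xy.
apply: fine_le; [exact: m_fin|exact: m_fin|].
apply: le_measure; rewrite ?inE//.
by move=> z /=; rewrite !in_itv/= !andbT; exact: le_trans.
Qed.

Variables (G phi : R -> R) (c C : R).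
Hypothesis mG : measurable_fun [set: R] G.
Hypothesis GC : forall v, `|G v| <= C.
Hypothesis mphi : measurable_fun [set: R] phi.
Hypothesis phiE : forall w, - M < w < M ->
  phi w = c + \int[mu]_v (if - M <= v <= w then G v else 0).

Let F (w v : R) := if (- M <= v <= M) && (v <= w) then G v else 0.

Let mF : measurable_fun setT (fun z : measurableTypeR R * measurableTypeR R => F z.1 z.2).
Proof.
apply: measurable_fun_ifT => //.
  apply: measurable_and; first by apply: measurable_and; apply: measurable_fun_ler.
  exact: measurable_fun_ler.
exact: (measurableT_comp mG).
Qed.

Let FC w v : `|F w v| <= C.
Proof. by rewrite /F; case: ifP => //; rewrite normr0 (le_trans _ (GC v)). Qed.

Let iF1 w : mu.-integrable setT (EFin \o F w).
Proof.
apply: (@integrable_bounded_supp _ _ M C) => //.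
  exact: (measurable_fun_pair2 w mF).
by move=> v; rewrite ltNge ler_norml /F => /negbTE ->.
Qed.

Let iF2 v : m.-integrable setT (EFin \o F^~ v).
Proof.
apply: (@integrable_dominated _ _ _ _ _ (cst C)).
- exact: (measurable_fun_pair1 v mF).
- exact: finite_measure_integrable_cst.
- by move=> w; exact: FC.
Qed.

Let Fphi w : \int[mu]_v `|F w v| <= C * (2 * M).
Proof.
apply: (le_trans (ler_norm _)); apply: norm_Rintegral_bounded_supp; last 2 first.
- by move=> v; rewrite normr_id.
- by move=> v; rewrite ltNge ler_norml /F => /negbTE ->; rewrite normr0.
- by apply: measurableT_comp => //; exact: (measurable_fun_pair2 w mF).
- exact: ltW.
Qed.

Let ic (k : R) : m.-integrable setT (EFin \o (fun=> k)).
Proof. exact: finite_measure_integrable_cst. Qed.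

(** Integration by parts, as Fubini's theorem for the indicator of [v <= w]. *)
Lemma integral_tail_representation : (\int[m]_w (phi w)%:E)%E =
  (c * fine (m setT) + \int[mu]_v (if - M <= v <= M then G v * tail_mass v else 0))%:E.
Proof.
have iI := integrable_fubini1 mF iF1 (ic _) Fphi.
have ip : m.-integrable setT (EFin \o (fun w => c + \int[mu]_v F w v)).
  by have := integrableD measurableT (ic c) iI; apply: eq_integrable.
have -> : (\int[m]_w (phi w)%:E)%E = (\int[m]_w (c + \int[mu]_v F w v)%:E)%E.
  apply: ae_eq_integral => //.
  - exact/measurable_EFinP.
  - by have /integrableP[] := ip.
  - exists (~` `]- M, M[); split => //; first by apply: measurableC; exact: measurable_itv.
    move=> w /= /not_implyP[_]; apply: contra_not => /=; rewrite in_itv/= => wM.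
    congr EFin; rewrite phiE//; congr (_ + _).
    apply: eq_Rintegral => v _; rewrite /F.
    congr (if _ then _ else _); case/andP: wM => ? ?.
    apply/idP/idP => [/andP[a1 a2]|/andP[/andP[a1 a2] a3]].
      by rewrite a1 a2 andbT; lra.
    by rewrite a1 a3.
rewrite -EFin_Rintegral//; congr EFin.
rewrite RintegralD//; congr (_ + _); first by rewrite Rintegral_cst.
rewrite (Rintegral_fubini mF iF1 iF2 (ic _) Fphi).
apply: eq_Rintegral => v _; rewrite /F.
case: ifPn => vM /=; last by rewrite Rintegral_cst// mul0r.
have -> : \int[m]_w (if v <= w then G v else 0) = \int[m]_(w in `[v, +oo[) (G v).
  rewrite [RHS]Rintegral_mkcond; apply: eq_Rintegral => w _.
  by rewrite patchE mem_setE in_itv/= andbT.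
by rewrite Rintegral_cst//; exact: measurable_itv.
Qed.

End tail_representation.

Section charge_representation.
Context {R : realType}.
Local Notation mu := (@lebesgue_measure R).
Variables (sigma : {charge set (measurableTypeR R) -> \bar R}) (M : R).
Hypothesis M0 : 0 < M.
Hypothesis supp : charge_support sigma `<=` `]- M, M[.
Hypothesis moments : forall k : nat, (k <= 1)%N ->
  charge_integral sigma (fun w : R => (w ^+ k)%:E) = 0%E.

Let p : {finite_measure set (measurableTypeR R) -> \bar R} := jordan_pos (projT2 (hahn_pair sigma)).
Let q : {finite_measure set (measurableTypeR R) -> \bar R} := jordan_neg (projT2 (hahn_pair sigma)).

(** Every point outside the support has a null neighbourhood; countably many
intervals with rational end points suffice to cover the complement. *)
Lemma charge_variation_out : (p (~` `](- M)%R, M[) + q (~` `](- M)%R, M[) = 0)%E.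
Proof.
pose F (n : nat) : set (measurableTypeR R) :=
  if @unpickle (rat * rat)%type n is Some ab then
    if charge_total_variation sigma `]ratr ab.1, ratr ab.2[%classic == 0%E
    then `]ratr ab.1, ratr ab.2[%classic else set0
  else set0.
have F0 n : measurable (F n) /\ p (F n) = 0%E /\ q (F n) = 0%E.
  rewrite /F; case: unpickle => [[a b]|]; last by rewrite !measure0.
  case: ifPn => [/eqP E|_]; last by rewrite !measure0.
  split => //; have : (p `]ratr a, ratr b[%classic + q `]ratr a, ratr b[%classic = 0)%E by exact: E.
  by move=> /eqP; rewrite padde_eq0// => /andP[/eqP -> /eqP ->].
have sub : (~` `]- M, M[ : set (measurableTypeR R)) `<=` \bigcup_n F n.
  move=> x /= xM; have : ~ charge_support sigma x by move=> /supp.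
  move=> /existsNP[U /not_implyP[[oU Ux]]] U0.
  have TU : charge_total_variation sigma U = 0%E.
    apply/eqP; rewrite eq_le; apply/andP; split; first by rewrite leNgt; apply/negP.
    by apply: adde_ge0.
  have [e /= e0 He] := open_subball oU Ux.
  have e20 : 0 < e / 2 by rewrite divr_gt0.
  have [a Ha] : exists a, ratr a \in `]x - e / 2, x[ by apply: rat_in_itvoo; lra.
  have [b Hb] : exists b, ratr b \in `]x, x + e / 2[ by apply: rat_in_itvoo; lra.
  move: Ha Hb; rewrite !in_itv/= => /andP[a1 a2] /andP[b1 b2].
  have abU : `]ratr a, ratr b[ `<=` U.
    apply: subset_trans (He (e / 2) _ e20); last by rewrite /ball/= sub0r normrN gtr0_norm//; lra.
    move=> y; rewrite /= in_itv/= => /andP[y1 y2].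
    by rewrite /ball/= ltr_distl; apply/andP; split; lra.
  have mU : measurable (U : set (measurableTypeR R)) by exact: open_measurable.
  have mab : measurable (`]ratr a, ratr b[ : set (measurableTypeR R)) by exact: measurable_itv.
  exists (pickle (a, b)); [exact: I|rewrite /F pickleK].
  rewrite ifT /=; first by rewrite in_itv/= a2 b1.
  rewrite eq_le; apply/andP; split; last by apply: adde_ge0.
  by rewrite -TU; apply: leeD; apply: le_measure; rewrite ?inE.
have mO : measurable (~` `]- M, M[ : set (measurableTypeR R)) by apply: measurableC; exact: measurable_itv.
have pz : p (~` `]- M, M[) = 0%E.
  apply/(negligibleP p mO).
  apply: (negligibleS sub).
  by apply: negligible_bigcup => n; apply/negligibleP; apply F0.
have qz : q (~` `]- M, M[) = 0%E.
  apply/(negligibleP q mO); apply: (negligibleS sub).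
  by apply: negligible_bigcup => n; apply/negligibleP; apply F0.
by rewrite pz qz adde0.
Qed.

Let pM : p (~` `]- M, M[) = 0%E.
Proof. by have /eqP := charge_variation_out; rewrite padde_eq0// => /andP[/eqP]. Qed.
Let qM : q (~` `]- M, M[) = 0%E.
Proof. by have /eqP := charge_variation_out; rewrite padde_eq0// => /andP[_ /eqP]. Qed.

Let S v := if - M <= v <= M then tail_mass p v - tail_mass q v else 0.

Let mS : measurable_fun [set: R] S.
Proof.
apply: measurable_fun_ifT => //; first by apply: measurable_and; exact: measurable_fun_ler.
by apply: measurable_funB; exact: measurable_tail_mass.
Qed.

Let SV v : `|S v| <= fine (p setT) + fine (q setT).
Proof.
have := tail_mass_ge0 p v; have := tail_mass_le p v.
have := tail_mass_ge0 q v; have := tail_mass_le q v.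
rewrite /S; case: ifP => _ ? ? ? ?; rewrite ler_norml; apply/andP; split; lra.
Qed.

Let SM v : M < `|v| -> S v = 0.
Proof. by rewrite ltNge ler_norml /S => /negbTE ->. Qed.

Let rep0 (G phi : R -> R) (c C : R) : measurable_fun [set: R] G -> (forall v, `|G v| <= C) ->
  measurable_fun [set: R] phi ->
  (forall w, - M < w < M -> phi w = c + \int[mu]_v (if - M <= v <= w then G v else 0)) ->
  charge_integral sigma (fun w => (phi w)%:E) =
  (c * (fine (p setT) - fine (q setT)) + \int[mu]_v (G v * S v))%:E.
Proof.
move=> mG GC mphi phiE.
rewrite /charge_integral -/p -/q.
rewrite (integral_tail_representation M0 pM mG GC mphi phiE).
rewrite (integral_tail_representation M0 qM mG GC mphi phiE).
have iGP (m : {finite_measure set (measurableTypeR R) -> \bar R}) :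
    mu.-integrable setT (EFin \o (fun v => if - M <= v <= M then G v * tail_mass m v else 0)).
  apply: (@integrable_bounded_supp _ _ M (C * fine (m setT))).
  - apply: measurable_fun_ifT => //; first by apply: measurable_and; exact: measurable_fun_ler.
    by apply: measurable_funM => //; exact: measurable_tail_mass.
  - have C0 : 0 <= C by apply: le_trans (GC 0).
    move=> v; case: ifP => _; last by rewrite normr0 mulr_ge0// fine_ge0.
    by rewrite normrM ler_pM// ger0_norm ?tail_mass_ge0// tail_mass_le.
  - by move=> v; rewrite ltNge ler_norml => /negbTE ->.
rewrite -EFinB; congr EFin.
have -> : \int[mu]_v (G v * S v) = \int[mu]_v ((if - M <= v <= M then G v * tail_mass p v else 0) -
   (if - M <= v <= M then G v * tail_mass q v else 0)).
  by apply: eq_Rintegral => v _; rewrite /S; case: ifP => _; ring.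
rewrite RintegralB//; ring.
Qed.

Let mass_eq : fine (p setT) - fine (q setT) = 0.
Proof.
have m0 := moments (leq0n 1).
have H := @rep0 (cst 0) (fun w => w ^+ 0) 1 0.
have := m0; rewrite H.
- have -> : \int[mu]_v (cst 0 v * S v) = 0.
    by under eq_Rintegral do rewrite /= mul0r; rewrite Rintegral_cst// mul0r.
  by rewrite mul1r addr0 => -[].
- exact: measurable_cst.
- by move=> v; rewrite /= normr0.
- exact: measurable_cst.
- move=> w _; rewrite expr0; under eq_Rintegral do rewrite if_same.
  by rewrite Rintegral_cst// mul0r addr0.
Qed.

(** [S] is the tail function of the charge on [-M, M]. The moment of order 0, which
makes this tail vanish further to the left, removes the constant [c]; the moment
of order 1 is, up to sign, the integral of [S]. *)
Theorem charge_integral_representation : exists (S : R -> R) (V : R),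
  [/\ measurable_fun [set: R] S, forall v, `|S v| <= V, forall v, M < `|v| -> S v = 0,
     \int[mu]_v S v = 0 &
     forall (G phi : R -> R) (c C : R), measurable_fun [set: R] G -> (forall v, `|G v| <= C) ->
       measurable_fun [set: R] phi ->
       (forall w, - M < w < M -> phi w = c + \int[mu]_v (if - M <= v <= w then G v else 0)) ->
       charge_integral sigma (fun w => (phi w)%:E) = (\int[mu]_v (G v * S v))%:E].
Proof.
have rep (G phi : R -> R) (c C : R) : measurable_fun [set: R] G -> (forall v, `|G v| <= C) ->
       measurable_fun [set: R] phi ->
       (forall w, - M < w < M -> phi w = c + \int[mu]_v (if - M <= v <= w then G v else 0)) ->
       charge_integral sigma (fun w => (phi w)%:E) = (\int[mu]_v (G v * S v))%:E.
  by move=> mG GC mphi phiE; rewrite (rep0 mG GC mphi phiE) mass_eq mulr0 add0r.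
exists S, (fine (p setT) + fine (q setT)); split => //.
have m1 := moments (leqnn 1).
have H := @rep (cst 1) (fun w => w ^+ 1) (- M) 1.
have := m1; rewrite H.
- by move=> [<-]; apply: eq_Rintegral => v _; rewrite /= mul1r.
- exact: measurable_cst.
- by move=> v; rewrite /= normr1.
- exact: exprn_measurable.
- move=> w /andP[w1 _]; rewrite Rintegral_itv_cst; last exact: ltW.
  by rewrite expr1; ring.
Qed.

End charge_representation.

(** * The scale integral as a convolution *)

Section theta_formula.
Context {R : realType}.
Local Notation mu := (@lebesgue_measure R).

Variables (S : R -> R) (V M : R).
Hypotheses (V0 : 0 <= V) (M0 : 0 < M).
Hypothesis mS : measurable_fun [set: R] S.
Hypothesis SV : forall v, `|S v| <= V.
Hypothesis SM : forall v, M < `|v| -> S v = 0.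
Hypothesis S0 : \int[mu]_v S v = 0.

Let iS : mu.-integrable setT (EFin \o S).
Proof. exact: (integrable_bounded_supp mS SV SM). Qed.

Definition primitive (t : R) := \int[mu]_v (if v <= t then S v else 0).
Local Notation Psi := primitive.

Let iSif (b : R -> bool) : measurable_fun [set: R] b ->
  mu.-integrable setT (EFin \o (fun v => if b v then S v else 0)).
Proof.
move=> mb; apply: (@integrable_bounded_supp _ _ M V).
- exact: measurable_fun_ifT.
- by move=> v; case: ifP => // _; rewrite normr0.
- by move=> v /SM ->; rewrite if_same.
Qed.

Lemma primitiveB a b : a <= b -> Psi b - Psi a = \int[mu]_v (if a < v <= b then S v else 0).
Proof.
move=> ab; rewrite /primitive -RintegralB//; last 2 first.
- by apply: iSif; exact: measurable_fun_ler.
- by apply: iSif; exact: measurable_fun_ler.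
apply: eq_Rintegral => v _; have [va|av] := leP v a; last by rewrite subr0.
by rewrite (le_trans va ab) subrr.
Qed.

Lemma primitive_lipschitz a b : `|Psi a - Psi b| <= V * `|a - b|.
Proof.
wlog ab : a b / a <= b.
  move=> H; have [/H//|/ltW/H] := leP a b; by rewrite distrC [`|b - a|]distrC.
rewrite distrC primitiveB// distrC [`|b - a|]ger0_norm ?subr_ge0//.
apply: (le_trans (lebesgue_norm_le _ (integrable_itv_cst a b V) _)); last by rewrite Rintegral_itv_cst.
- apply: measurable_fun_ifT => //; apply: measurable_and; first exact: measurable_fun_ltr.
  exact: measurable_fun_ler.
- move=> v; case: ifPn => [/andP[/ltW -> ->]//|_]; rewrite normr0; by case: ifP.
Qed.

Lemma primitive_out t : M <= `|t| -> Psi t = 0.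
Proof.
rewrite ler_normr => /orP[Mt|Mt].
  rewrite -S0; apply: eq_Rintegral => v _; case: leP => // tv.
  by rewrite SM//; apply: lt_le_trans (ler_norm v); exact: le_lt_trans tv.
transitivity (\int[mu]_v (cst 0 v : R)); last by rewrite Rintegral_cst// mul0r.
apply: (@eq_Rintegral_off_point _ (- M)) => v vM; case: ifP => //= vt; rewrite SM//.
have : v < - M by rewrite lt_neqAle vM/=; lra.
move=> h; rewrite ltr0_norm; have := M0; lra.
Qed.

Variables (g : R -> R) (L : R).
Hypothesis L0 : 0 <= L.
Hypothesis mg : measurable_fun [set: R] g.
Hypothesis gL : forall t, `|g t| <= L.

Let mgx h x : measurable_fun [set: R] (fun v => g (h * v + x)).
Proof. by apply: (measurableT_comp mg); apply: measurable_funD => //; exact: measurable_funM. Qed.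

Variables (eps x : R).
Hypotheses (e0 : 0 < eps) (e1 : eps < 1).

Lemma primitive_quotient_le u : `|(Psi (u / eps) - Psi u) / u| <= V / eps.
Proof.
have [->|u0] := eqVneq u 0; first by rewrite invr0 mulr0 normr0 divr_ge0// ltW.
have up : 0 < `|u| by rewrite normr_gt0.
rewrite normrM normfV ler_pdivrMr//.
apply: (le_trans (primitive_lipschitz _ _)); rewrite -mulrA ler_wpM2l//.
have -> : u / eps - u = (eps^-1 - 1) * u by ring.
rewrite normrM ler_wpM2r// ger0_norm; first by rewrite gerBl.
by rewrite subr_ge0 invf_ge1// ltW.
Qed.

Lemma measurable_primitive : measurable_fun [set: R] Psi.
Proof. by apply: continuous_measurable_fun; exact: lipschitz_continuous primitive_lipschitz. Qed.

Let F (h v : R) := if eps <= h <= 1 then h^-1 * (g (h * v + x) * S v) else 0.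

Let A := 1 + M.
Let A0 : 0 <= A. Proof. by rewrite addr_ge0// ltW. Qed.

Let mF : measurable_fun setT (fun z : measurableTypeR R * measurableTypeR R => F z.1 z.2).
Proof.
apply: measurable_fun_ifT => //.
  by apply: measurable_and; apply: measurable_fun_ler.
apply: measurable_funM; first exact: (measurableT_comp measurable_inv_fun).
apply: measurable_funM; last exact: (measurableT_comp mS).
apply: (measurableT_comp mg); apply: measurable_funD => //; exact: measurable_funM.
Qed.

Let FC h v : `|F h v| <= eps^-1 * (L * V).
Proof.
rewrite /F; case: ifPn => [/andP[h1 h2]|_]; last by rewrite normr0 !mulr_ge0// invr_ge0 ltW.
have h0 : 0 < h by apply: lt_le_trans h1.
rewrite normrM normfV (gtr0_norm h0); apply: ler_pM; rewrite ?invr_ge0 ?(ltW h0)//.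
  by rewrite lef_pV2 ?posrE.
by rewrite normrM ler_pM.
Qed.

Let FA1 h v : A < `|h| -> F h v = 0.
Proof.
move=> Ah; rewrite /F; case: ifPn => // /andP[h1 h2]; move: Ah.
have h0 : 0 < h by apply: lt_le_trans h1.
rewrite gtr0_norm// /A; have := M0; lra.
Qed.

Let FA2 h v : A < `|v| -> F h v = 0.
Proof.
move=> Av; rewrite /F SM ?mulr0 ?if_same//.
by move: Av; rewrite /A; lra.
Qed.

(** The scale integral as a double integral of a bounded function. *)
Lemma scale_integral : (\int[mu]_(h in `[eps, 1%R]) ((h * \int[mu]_v (g (h * v + x)%R * S v)%R)%:E * (h ^- 2)%:E))%E
  = (\int[mu]_h \int[mu]_v F h v)%:E.
Proof.
have iI : mu.-integrable setT (EFin \o (fun h => \int[mu]_v F h v)).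
  apply: (@integrable_bounded_supp _ _ A (eps^-1 * (L * V) * (2 * A))).
  - exact: (measurable_fubini_bounded A0 mF FC FA1 FA2).
  - by move=> h; exact: (norm_fubini_bounded A0 mF FC FA2).
  - move=> h Ah; under eq_Rintegral do rewrite FA1//.
    by rewrite Rintegral_cst// mul0r.
rewrite EFin_Rintegral// [LHS]integral_mkcond; apply: eq_integral => h _.
rewrite patchE mem_setE in_itv/=; case: ifPn => hI; last first.
  rewrite /F; under eq_Rintegral do rewrite (negbTE hI).
  by rewrite Rintegral_cst// mul0r.
rewrite -EFinM; congr EFin; rewrite /F hI.
have h0 : 0 < h by case/andP: hI => + _; exact: lt_le_trans.
rewrite RintegralZl//; last first.
  apply: (@integrable_bounded_supp _ _ M (L * V)).
  - by apply: measurable_funM.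
  - by move=> v; rewrite normrM ler_pM.
  - by move=> v /SM ->; rewrite mulr0.
by field; rewrite gt_eqF.
Qed.

Let W (v u : R) := if eps <= u / v <= 1 then S v * (g (u + x) / `|u|) else 0.

(** The substitution [u = h * v] in the scale variable. *)
Let inner v : v != 0 -> \int[mu]_h F h v = \int[mu]_u W v u.
Proof.
move=> v0; have vp : 0 < `|v| by rewrite normr_gt0.
pose w (u : R) := if eps <= u / v <= 1 then (u / v)^-1 * (g (u + x) * S v) else 0.
have mw : measurable_fun [set: R] w.
  apply: measurable_fun_ifT => //.
    by apply: measurable_and; apply: measurable_fun_ler => //; apply: measurable_funM.
  apply: measurable_funM; first by apply: (measurableT_comp measurable_inv_fun); exact: measurable_funM.
  by apply: measurable_funM => //; apply: (measurableT_comp mg); exact: measurable_funD.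
have iw : mu.-integrable setT (EFin \o w).
  apply: (@integrable_bounded_supp _ _ `|v| (eps^-1 * (L * V))) => //.
    move=> u; rewrite /w; case: ifPn => [/andP[h1 h2]|_]; last by rewrite normr0 !mulr_ge0// invr_ge0 ltW.
    have h0 : 0 < u / v by apply: lt_le_trans h1.
    rewrite normrM normfV (gtr0_norm h0); apply: ler_pM; rewrite ?invr_ge0 ?(ltW h0)//.
      by rewrite lef_pV2 ?posrE.
    by rewrite normrM ler_pM.
  move=> u uv; rewrite /w; case: ifPn => // /andP[h1 h2].
  have h0 : 0 < u / v by apply: lt_le_trans h1.
  move: h2; rewrite -(gtr0_norm h0) normrM normfV ler_pdivrMr// mul1r => h2.
  by move: uv; rewrite ltNge h2.
have -> : \int[mu]_h F h v = \int[mu]_h w (v * h + 0).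
  apply: eq_Rintegral => h _; rewrite addr0 /F /w [v * h]mulrC.
  by have -> : h * v / v = h by field.
rewrite Rintegral_affine// -RintegralZl//; apply: eq_Rintegral => u _.
rewrite /w /W; case: ifPn => [/andP[h1 _]|_]; last by rewrite mulr0.
have h0 : 0 < u / v by apply: lt_le_trans h1.
have u0 : u != 0 by apply: contraTN h0 => /eqP ->; rewrite mul0r ltxx.
have -> : (u / v)^-1 = `|v| / `|u|.
  by rewrite -(gtr0_norm h0) normrM normfV invfM invrK mulrC.
by field; rewrite !normr_eq0 u0 v0.
Qed.

Let mW : measurable_fun setT (fun z : measurableTypeR R * measurableTypeR R => W z.1 z.2).
Proof.
have mi : measurable_fun setT (fun z : measurableTypeR R * measurableTypeR R => z.2 / z.1).
  by apply: measurable_funM => //; exact: (measurableT_comp measurable_inv_fun).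
apply: measurable_fun_ifT => //.
  by apply: measurable_and; apply: measurable_fun_ler.
apply: measurable_funM; first exact: (measurableT_comp mS).
apply: measurable_funM; first by apply: (measurableT_comp mg); exact: measurable_funD.
by apply: (measurableT_comp measurable_inv_fun); exact: measurableT_comp.
Qed.

Let WC v u : v != 0 -> `|W v u| <= if - `|v| <= u <= `|v| then V * L / (eps * `|v|) else 0.
Proof.
move=> v0; have vp : 0 < `|v| by rewrite normr_gt0.
have c0 : 0 <= V * L / (eps * `|v|) by rewrite divr_ge0 ?mulr_ge0// ltW.
rewrite /W; case: ifPn => [/andP[h1 h2]|_]; last by rewrite normr0; case: ifP.
have h0 : 0 < u / v by apply: lt_le_trans h1.
move: h1 h2; rewrite -(gtr0_norm h0) normrM normfV ler_pdivrMr// ler_pdivlMr// mul1r => h1 h2.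
have up : 0 < `|u| by apply: lt_le_trans h1; rewrite mulr_gt0.
rewrite -ler_norml h2 !normrM normfV normr_id mulrA ler_pM ?mulr_ge0 ?invr_ge0//; first by rewrite ler_pM.
by rewrite lef_pV2 ?posrE// mulr_gt0.
Qed.

Let W0 u : W 0 u = 0.
Proof. by rewrite /W invr0 mulr0 leNgt e0. Qed.

Let iW1 v : mu.-integrable setT (EFin \o W v).
Proof.
have [->|v0] := eqVneq v 0.
  apply: (@eq_integrable _ _ _ _ _ _ (EFin \o (fun=> 0))) => //; last exact: integrable0.
  by move=> u _; rewrite /= W0.
apply: (lebesgue_dominated _ (integrable_itv_cst _ _ _) (fun u => WC u v0)).
exact: (measurable_fun_pair2 v mW).
Qed.

Let iW2 u : mu.-integrable setT (EFin \o W^~ u).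
Proof.
apply: (@integrable_bounded_supp _ _ M (V * (L / `|u|))).
- exact: (measurable_fun_pair1 u mW).
- move=> v; rewrite /W; case: ifP => _; last by rewrite normr0 mulr_ge0// divr_ge0.
  by rewrite normrM ler_pM// normrM normfV normr_id ler_pM// invr_ge0.
- by move=> v /SM Sv; rewrite /W Sv mul0r if_same.
Qed.

Let Wphi v : \int[mu]_u `|W v u| <= if - M <= v <= M then 2 * V * L / eps else 0.
Proof.
have [->|v0] := eqVneq v 0.
  under eq_Rintegral do rewrite W0 normr0.
  rewrite Rintegral_cst// mul0r; case: ifP => // _.
  by rewrite !mulr_ge0// invr_ge0 ltW.
have vp : 0 < `|v| by rewrite normr_gt0.
rewrite -ler_norml; have [vM|Mv] := leP `|v| M; last first.
  under eq_Rintegral => u _.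
    rewrite (_ : `|W v u| = 0); last by rewrite /W SM// mul0r if_same normr0.
    over.
  by rewrite Rintegral_cst// mul0r.
apply: (@le_trans _ _ (\int[mu]_u (if - `|v| <= u <= `|v| then V * L / (eps * `|v|) else 0))).
  apply: le_Rintegral => //.
  - exact: integrable_norm.
  - exact: integrable_itv_cst.
  - by move=> u _; exact: WC.
rewrite Rintegral_itv_cst; last by lra.
by rewrite le_eqVlt; apply/orP; left; apply/eqP; field; rewrite !gt_eqF.
Qed.

(** After exchanging the integrals the condition on [v] describes the interval
between [u] and [u / eps], up to one end point. *)
Let column u : \int[mu]_v W v u = g (u + x) * ((Psi (u / eps) - Psi u) / u).
Proof.
have iJ : measurable_fun [set: R] (fun v => eps <= u / v <= 1).
  by apply: measurable_and; apply: measurable_fun_ler => //; apply: measurable_funM => //;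
  exact: (measurableT_comp measurable_inv_fun).
have -> : \int[mu]_v W v u = g (u + x) / `|u| * \int[mu]_v (if eps <= u / v <= 1 then S v else 0).
  rewrite -RintegralZl//; last exact: iSif.
  by apply: eq_Rintegral => v _; rewrite /W; case: ifP => _; rewrite ?mulr0// mulrC.
have [u0|u0|->] := ltgtP u 0; last by rewrite normr0 invr0 !mulr0 mul0r.
- have ue : u / eps <= u.
    by have := e1; rewrite ler_pdivrMr// => ?; nra.
  rewrite ltr0_norm// -[Psi (u / eps) - Psi u]opprB primitiveB//.
  have -> : \int[mu]_v (if eps <= u / v <= 1 then S v else 0) = \int[mu]_v (if u / eps < v <= u then S v else 0); last first.
    by field; rewrite lt_eqF.
  apply: (@eq_Rintegral_off_point _ (u / eps)) => v vu; congr (if _ then _ else _).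
  have [v0|v0|v0] := ltgtP v 0.
  + rewrite ler_ndivlMr// ler_ndivrMr// mul1r [u / eps < v]lt_neqAle eq_sym vu/=.
    by rewrite ler_pdivrMr// [v * eps]mulrC.
  + rewrite leNgt (lt_trans _ e0) ?pmulr_llt0 ?invr_gt0//=.
    by apply/esym/negbTE; rewrite negb_and -!ltNge (lt_trans u0 v0) orbT.
  + rewrite v0 invr0 mulr0 leNgt e0/=.
    by apply/esym/negbTE; rewrite negb_and -!ltNge u0 orbT.
- have ue : u <= u / eps.
    by have := e1; rewrite ler_pdivlMr// => ?; nra.
  rewrite gtr0_norm// primitiveB//.
  have -> : \int[mu]_v (if eps <= u / v <= 1 then S v else 0) = \int[mu]_v (if u < v <= u / eps then S v else 0); last first.
    by field; rewrite gt_eqF.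
  apply: (@eq_Rintegral_off_point _ u) => v vu; congr (if _ then _ else _).
  have [v0|v0|v0] := ltgtP v 0.
  + rewrite leNgt (lt_trans _ e0) ?pmulr_rlt0 ?invr_lt0//=.
    by apply/esym/negbTE; rewrite negb_and -!leNgt (ltW (lt_trans v0 u0)).
  + rewrite ler_pdivlMr// ler_pdivrMr// mul1r [u < v]lt_neqAle eq_sym vu/=.
    by rewrite ler_pdivlMr// andbC [v * eps]mulrC.
  + rewrite v0 invr0 mulr0 leNgt e0/=.
    by apply/esym/negbTE; rewrite negb_and -!leNgt (ltW u0).
Qed.

(** The scale integral is the convolution of [g] with the difference of
[Psi (- t) / t] and its dilate by [eps], normalised in L1. *)
Theorem scale_integral_primitive :
  [/\ mu.-integrable setT (EFin \o (fun t => g (x - t) * ((Psi (- t) - Psi (- (t / eps))) / t))) &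
   (\int[mu]_(h in `[eps, 1%R]) ((h * \int[mu]_v (g (h * v + x)%R * S v)%R)%:E * (h ^- 2)%:E))%E
   = (\int[mu]_t (g (x - t) * ((Psi (- t) - Psi (- (t / eps))) / t)))%:E].
Proof.
have N10 : (-1 : R) != 0 by rewrite oppr_eq0 oner_eq0.
pose k u := g (u + x) * ((Psi (u / eps) - Psi u) / u).
have ik : mu.-integrable setT (EFin \o k).
  apply: (@integrable_bounded_supp _ _ M (L * (V / eps))).
  - apply: measurable_funM; first by apply: (measurableT_comp mg); exact: measurable_funD.
    apply: measurable_funM; last exact: measurable_inv_fun.
    apply: measurable_funB; last exact: measurable_primitive.
    by apply: (measurableT_comp measurable_primitive); exact: measurable_funM.
  - by move=> u; rewrite normrM ler_pM// primitive_quotient_le.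
  - move=> u Mu; rewrite /k !primitive_out ?subrr ?mul0r ?mulr0//; first exact: ltW.
    rewrite normrM normfV (gtr0_norm e0) ler_pdivlMr// (le_trans _ (ltW Mu))//.
    by rewrite ler_piMr// ltW.
have kE t : g (x - t) * ((Psi (- t) - Psi (- (t / eps))) / t) = k (-1 * t + 0).
  by rewrite /k mulN1r addr0 [- t + x]addrC mulNr invrN mulrN -mulNr opprB.
split.
  have := integrable_affine 0 N10 ik; apply: eq_integrable => //.
  by move=> t _; rewrite /= kE.
rewrite scale_integral; congr EFin.
under [RHS]eq_Rintegral do rewrite kE.
rewrite Rintegral_affine// normrN1 invr1 mul1r.
rewrite (Rintegral_fubini_bounded A0 mF FC FA1 FA2).
transitivity (\int[mu]_v \int[mu]_u W v u); first exact: (eq_Rintegral_off_point inner).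
rewrite (Rintegral_fubini mW iW1 iW2 (integrable_itv_cst _ _ _) Wphi).
by apply: eq_Rintegral => u _; rewrite column.
Qed.

End theta_formula.

(** * Comparison with the truncated convolution *)

Section comparison.
Context {R : realType}.
Local Notation mu := (@lebesgue_measure R).
Variables (f g : R -> R) (L B : R).
Hypotheses (L0 : 0 < L) (B0 : 0 < B).
Hypothesis fL : forall x y, `|f x - f y| <= L * `|x - y|.
Hypothesis mg : measurable_fun [set: R] g.
Hypothesis gL : forall t, `|g t| <= L.
Hypothesis gB : forall t, B < `|t| -> g t = 0.
Hypothesis fg : forall a b, a <= b -> f b - f a = \int[mu]_y (if a <= y <= b then g y else 0).
Hypothesis aeg : {ae mu, forall x, derive1 f x = g x}.
Variables (sigma : {charge set (measurableTypeR R) -> \bar R}) (S : R -> R) (V M : R).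
Hypotheses (V0 : 0 <= V) (M0 : 0 < M).
Hypothesis mS : measurable_fun [set: R] S.
Hypothesis SV : forall v, `|S v| <= V.
Hypothesis SM : forall v, M < `|v| -> S v = 0.
Hypothesis S0 : \int[mu]_v S v = 0.
Hypothesis sigmaE : forall (G phi : R -> R) (c C : R), measurable_fun [set: R] G ->
  (forall v, `|G v| <= C) -> measurable_fun [set: R] phi ->
  (forall w, - M < w < M -> phi w = c + \int[mu]_v (if - M <= v <= w then G v else 0)) ->
  charge_integral sigma (fun w => (phi w)%:E) = (\int[mu]_v (G v * S v))%:E.

Let Phi t := primitive S (- t).

Let PhiV s t : `|Phi s - Phi t| <= V * `|s - t|.
Proof.
have := primitive_lipschitz V0 mS SV SM (- s) (- t).
by rewrite -opprD normrN.
Qed.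

Let PhiM t : M <= `|t| -> Phi t = 0.
Proof. by move=> tM; apply: (primitive_out M0 SM S0); rewrite normrN. Qed.

Lemma primitive_kernel_cz : calderon_zygmund_kernel (quotient_kernel Phi).
Proof. exact: (quotient_kernel_cz V0 M0 PhiV PhiM). Qed.

(** The charge annihilates constants, so only the variation of [f] along
[x + h * w] counts; it is an integral of [g]. *)
Lemma sigma_differenceE x h : 0 < h ->
  sigma_difference sigma f x h = (h * \int[mu]_v (g (h * v + x) * S v))%:E.
Proof.
move=> h0; have hn0 : h != 0 by rewrite gt_eqF.
have mgh : measurable_fun [set: R] (fun v => g (h * v + x)).
  by apply: (measurableT_comp mg); apply: measurable_funD => //; exact: measurable_funM.
have mfh : measurable_fun [set: R] (fun w => f (x + h * w)).
  have cf : continuous f by exact: lipschitz_continuous fL.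
  apply: (measurableT_comp (continuous_measurable_fun cf)).
  by apply: measurable_funD => //; exact: measurable_funM.
rewrite /sigma_difference (@sigmaE (fun v => h * g (h * v + x)) _ (f (x - h * M)) (h * L)) //.
- congr EFin; rewrite -RintegralZl//.
    by apply: eq_Rintegral => v _; rewrite mulrA.
  apply: (@integrable_bounded_supp _ _ M (L * V)).
  + exact: measurable_funM.
  + by move=> v; rewrite normrM ler_pM.
  + by move=> v /SM ->; rewrite mulr0.
- exact: measurable_funM.
- by move=> v; rewrite normrM (gtr0_norm h0) ler_wpM2l// ltW.
- move=> w /andP[w1 w2]; have ab : x - h * M <= x + h * w by nra.
  rewrite -[LHS](subrK (f (x - h * M))) (fg ab) addrC; congr (_ + _).
  have iF : mu.-integrable setT (EFin \o (fun y => if x - h * M <= y <= x + h * w then g y else 0)).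
    apply: (lebesgue_dominated _ (integrable_itv_cst (x - h * M) (x + h * w) L)).
      by apply: measurable_fun_ifT => //; apply: measurable_and; exact: measurable_fun_ler.
    by move=> y; case: ifP => _; rewrite ?normr0.
  have := Rintegral_affine x hn0 iF; rewrite (gtr0_norm h0) => E.
  have -> : \int[mu]_y (if x - h * M <= y <= x + h * w then g y else 0) = h * (h^-1 * \int[mu]_y (if x - h * M <= y <= x + h * w then g y else 0)).
    by rewrite mulrA divff// mul1r.
  rewrite -E -RintegralZl//; last exact: (integrable_affine x hn0 iF).
  apply: eq_Rintegral => v _; rewrite [h * v + x]addrC lerD2l -mulrN lerD2l !(ler_pM2l h0).
  by case: ifP => _ //; rewrite mulr0.
Qed.

Definition theta_kernel eps t := (Phi t - Phi (t / eps)) / t.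

Lemma thetaE x eps : 0 < eps -> eps < 1 ->
  mu.-integrable setT (EFin \o (fun t => g (x - t) * theta_kernel eps t)) /\
  theta sigma f eps x = (\int[mu]_t (g (x - t) * theta_kernel eps t))%:E.
Proof.
move=> e0 e1.
have [iT tE] := scale_integral_primitive V0 M0 mS SV SM S0 (ltW L0) mg gL x e0 e1.
split; first exact: iT.
rewrite -[RHS]tE /theta; apply: eq_integral => h.
rewrite mem_setE in_itv/= => /andP[h1 h2].
by rewrite sigma_differenceE// (lt_le_trans e0).
Qed.

Let trunc d x t := if d < `|t| then quotient_kernel Phi t * g (x - t) else 0.

Let mtr (d : R) : measurable_fun [set: R] (fun t : R => d < `|t|).
Proof. by apply: measurable_fun_ltr => //; exact: measurableT_comp. Qed.

Let mgt x : measurable_fun [set: R] (fun t => g (x - t)).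
Proof. by apply: (measurableT_comp mg); exact: measurable_funB. Qed.

Let itrunc d x : 0 < d -> mu.-integrable setT (EFin \o trunc d x).
Proof.
move=> d0; apply: (@integrable_bounded_supp _ _ M (V * M / d * L)).
- apply: measurable_fun_ifT => //; apply: measurable_funM => //.
  exact: (measurable_quotient_kernel PhiV).
- have c0 : 0 <= V * M / d by rewrite divr_ge0 ?mulr_ge0// ltW.
  move=> t; rewrite /trunc; case: ifPn => [dt|_]; last by rewrite normr0 mulr_ge0// ltW.
  by rewrite normrM ler_pM// (quotient_kernel_bound V0 M0 PhiV PhiM)// ltW.
- by move=> t /ltW Mt; rewrite /trunc (quotient_kernel_supp PhiM Mt) mul0r if_same.
Qed.

Lemma truncated_convolutionE d x : 0 < d ->
  truncated_convolution (quotient_kernel Phi) (derive1 f) d x = (\int[mu]_t trunc d x t)%:E.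
Proof.
move=> d0; rewrite /truncated_convolution integral_bool_set EFin_Rintegral; last exact: itrunc.
have N10 : (-1 : R) != 0 by rewrite oppr_eq0 oner_eq0.
case: aeg => N [mN N0 subN].
have [mN' N'0] := null_preimage_affine x N10 mN N0.
apply: (integral_off_null mN' N'0) => t /= Nt; rewrite /trunc; case: ifP => // _.
congr (_ * _)%:E; apply: contrapT => ne; apply: Nt; apply: subN => /= e.
by apply: ne; move: e; rewrite (_ : -1 * t + x = x - t)//; ring.
Qed.

(** For [eps * M < `|t|] the dilated term [Phi (t / eps)] vanishes and the two
kernels agree. For smaller [t] the kernel of [theta] is at most [V / eps], on a
set of length [2 * eps * M]. *)
Lemma theta_comparison x eps : 0 < eps -> eps < 1 ->
  `|\int[mu]_t (g (x - t) * theta_kernel eps t) - \int[mu]_t trunc (eps * M) x t| <= 2 * L * V * M.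
Proof.
move=> e0 e1; have [iT _] := thetaE x e0 e1.
have eM : 0 < eps * M by rewrite mulr_gt0.
have iK := itrunc x eM.
rewrite -RintegralB//.
have -> : 2 * L * V * M = L * (V / eps) * (2 * (eps * M)) by field; rewrite gt_eqF.
apply: norm_Rintegral_bounded_supp.
- apply: measurable_funB.
    by have /integrableP[/measurable_EFinP] := iT.
  by have /integrableP[/measurable_EFinP] := iK.
- exact: ltW.
- move=> t; rewrite /trunc; case: ifPn => [et|_]; last first.
    rewrite subr0 normrM ler_pM//.
    have := primitive_quotient_le V0 mS SV SM e0 e1 (- t).
    by rewrite /theta_kernel /Phi mulNr invrN mulrN -mulNr opprB.
  rewrite /theta_kernel [Phi (t / eps)]PhiM; last first.
    by rewrite normrM normfV (gtr0_norm e0) ler_pdivlMr// mulrC ltW.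
  by rewrite subr0 mulrC subrr normr0 !mulr_ge0 ?invr_ge0// ltW.
- move=> t et; rewrite /trunc et /theta_kernel [Phi (t / eps)]PhiM; last first.
    by rewrite normrM normfV (gtr0_norm e0) ler_pdivlMr// mulrC ltW.
  by rewrite subr0 mulrC subrr.
Qed.

(** [Phi t / t] differs from [Phi 0 / t] by a bounded kernel. *)
Lemma truncated_convolution_hilbert d x : 0 < d ->
  `|\int[mu]_t trunc d x t| <= `|Phi 0| * `|truncated_hilbert g d x| + V * L * (2 * B).
Proof.
move=> d0.
have N10 : (-1 : R) != 0 by rewrite oppr_eq0 oner_eq0.
pose k t := if d < `|x - t| then g t / (x - t) else 0.
have ik : mu.-integrable setT (EFin \o k).
  apply: (@integrable_bounded_supp _ _ B (L / d)).
  - apply: measurable_fun_ifT => //.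
      by apply: measurable_fun_ltr => //; apply: measurableT_comp => //; exact: measurable_funB.
    by apply: measurable_funM => //; apply: (measurableT_comp measurable_inv_fun); exact: measurable_funB.
  - move=> t; rewrite /k; case: ifPn => [dt|_]; last by rewrite normr0 divr_ge0// ltW.
    rewrite normrM normfV ler_pM ?invr_ge0// lef_pV2 ?posrE//; first exact: ltW.
    exact: lt_trans dt.
  - by move=> t /gB gt0; rewrite /k gt0 mul0r if_same.
have kE : truncated_hilbert g d x = \int[mu]_t k (-1 * t + x).
  by rewrite Rintegral_affine// normrN1 invr1 mul1r.
have ik' := integrable_affine x N10 ik.
pose r t := if d < `|t| then (Phi t - Phi 0) / t * g (x - t) else 0.
have mPhi : measurable_fun [set: R] Phi.
  by apply: continuous_measurable_fun; exact: lipschitz_continuous PhiV.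
have mr : measurable_fun [set: R] r.
  apply: measurable_fun_ifT => //; apply: measurable_funM => //.
  by apply: measurable_funM; [exact: measurable_funB|exact: measurable_inv_fun].
have rb t : `|r t| <= if x - B <= t <= x + B then V * L else 0.
  rewrite /r; case: ifPn => [dt|_]; last by rewrite normr0; case: ifP => // _; rewrite mulr_ge0// ltW.
  have t0 : 0 < `|t| by exact: lt_trans dt.
  rewrite -ler_distl distrC; have [xB|Bx] := leP `|x - t| B; last by rewrite gB// mulr0 normr0.
  rewrite normrM ler_pM// normrM normfV ler_pdivrMr//.
  by have := PhiV t 0; rewrite subr0.
have ir := lebesgue_dominated mr (integrable_itv_cst (x - B) (x + B) (V * L)) rb.
have -> : \int[mu]_t trunc d x t = \int[mu]_t (Phi 0 * k (-1 * t + x) + r t).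
  apply: eq_Rintegral => t _; rewrite /trunc /k /r.
  have -> : x - (-1 * t + x) = t by ring.
  have -> : -1 * t + x = x - t by ring.
  by case: ifP => _; [rewrite /quotient_kernel; ring|rewrite mulr0 addr0].
rewrite RintegralD//; last exact: lebesgue_integrableZ.
rewrite RintegralZl// -kE.
apply: (le_trans (ler_normD _ _)); rewrite normrM; apply: lerD => //.
apply: (le_trans (lebesgue_norm_le mr (integrable_itv_cst (x - B) (x + B) (V * L)) rb)).
rewrite Rintegral_itv_cst; last by have := B0; lra.
by have -> : x + B - (x - B) = 2 * B by ring.
Qed.

Theorem theta_convolution_bounded x :
  (ereal_sup [set `| theta sigma f eps x -
       truncated_convolution (quotient_kernel Phi) (derive1 f) (eps * M) x |
       | eps in [set eps : R | (0 < eps < 1)%R]] <= (2 * L * V * M)%:E)%E.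
Proof.
apply: ge_ereal_sup => _ [eps /= /andP[e0 e1] <-].
have eM : 0 < eps * M by rewrite mulr_gt0.
have [_ ->] := thetaE x e0 e1.
by rewrite truncated_convolutionE// -EFinB lee_fin theta_comparison.
Qed.

Theorem theta_bounded_ae :
  {ae mu, forall x, (ereal_sup [set `| theta sigma f eps x |
       | eps in [set eps : R | (0 < eps < 1)%R]] < +oo)%E}.
Proof.
have := truncated_hilbert_bounded (ltW L0) mg gL gB; apply: filterS; first exact: (ae_filter_ringOfSetsType mu).
move=> x [C HC].
apply: (@le_lt_trans _ _ (2 * L * V * M + (`|Phi 0| * C + V * L * (2 * B)))%:E); last by rewrite ltry.
apply: ge_ereal_sup => _ [eps /= /andP[e0 e1] <-].
have eM : 0 < eps * M by rewrite mulr_gt0.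
have [_ ->] := thetaE x e0 e1; rewrite lee_fin.
set a := \int[mu]_t _; have := theta_comparison x e0 e1; rewrite -/a.
set b := \int[mu]_t _ => hab.
have -> : a = (a - b) + b by rewrite subrK.
apply: (le_trans (ler_normD _ _)); apply: lerD => //.
apply: (le_trans (truncated_convolution_hilbert x eM)); rewrite lerD2r ler_wpM2l//.
exact: HC.
Qed.

End comparison.

Unset Implicit Arguments.
Local Open Scope ereal_scope.

Theorem theorem1p2 (R : realType) (f : R -> R)
    (sigma : {charge set (measurableTypeR R) -> \bar R}) (M : R)
    (f_lip : lipschitz f)
    (f_supp : compact (function_support f))
    (sigma_supp : compact (charge_support sigma))
    (sigma_moments : forall k : nat, (k <= 1)%N ->
       charge_integral sigma (fun w : R => (w ^+ k)%:E) = 0)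
    (M_gt0 : (0 < M)%R)
    (sigma_supp_M : charge_support sigma `<=` `](- M)%R, M[) :
  (exists2 K0 : R -> R, calderon_zygmund_kernel K0 &
     exists C : R, forall x : R,
       ereal_sup
         [set `| theta sigma f eps x -
                 truncated_convolution K0 (derive1 f) (eps * M) x |
            | eps in [set eps : R | (0 < eps < 1)%R]] <= C%:E)
  /\ {ae @lebesgue_measure R, forall x : R,
        ereal_sup
          [set `| theta sigma f eps x |
             | eps in [set eps : R | (0 < eps < 1)%R]] < +oo}.
Proof.
have [L L0 fL] := lipschitz_bound f_lip.
have [B B0 fB] := function_support_bounded f_supp.
have [g [mg gL gB fg aeg]] := lipschitz_density L0 B0 fL fB.
have [S [V [mS SV SM S0 sigmaE]]] :=
  charge_integral_representation M_gt0 sigma_supp_M sigma_moments.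
have V0 : (0 <= V)%R by apply: le_trans (SV 0%R).
split; last exact: (theta_bounded_ae L0 B0 fL mg gL gB fg V0 M_gt0 mS SV SM S0 sigmaE).
exists (quotient_kernel (fun t => primitive S (- t))).
  exact: (primitive_kernel_cz V0 M_gt0 mS SV SM S0).
exists (2 * L * V * M)%R => x.
exact: (theta_convolution_bounded L0 fL mg gL fg aeg V0 M_gt0 mS SV SM S0 sigmaE x).
Qed.
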